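(* Let $N\ge 2$, $0\le q<2$ and $p\ge 0$ be such that $p+q-1>0$, and assume that one of the following holds: (i) $1\le p<\frac{N+3}{N-1}$ and $p+q-1<\frac{4}{N-1}$; (ii) $0\le p<1$ and $p+q-1<\frac{(p+1)^2}{p(N-1)}$. Then there exist positive constants $a=a(N,p,q)$ and $c_1=c_1(N,p,q)$, depending only on $N,p,q$, such that for every $R>0$ and every positive solution $u$ of $$-\Delta u=u^p|\nabla u|^q\quad\text{in } B_R,$$ one has $$|\nabla u^a(0)|\le c_1R^{-1-a\frac{2-q}{p+q-1}}.$$
   Context: $B_R$ is the open ball of $\mathbb{R}^N$ with center $0$ and radius $R$. Solutions are classical, i.e. of class $C^2$. $\nabla u^a$ denotes the gradient of the function $u^a$. When $p=0$ the right-hand side $\frac{(p+1)^2}{p(N-1)}$ in (ii) is understood as $+\infty$. *)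

(* Defs.v *)
From HB Require Import structures.
From mathcomp Require Import all_boot all_order all_algebra.
From mathcomp Require Import all_classical all_reals all_analysis.
Import Order.TTheory GRing.Theory Num.Theory.
Import numFieldNormedType.Exports.

Set Implicit Arguments.
Unset Strict Implicit.
Unset Printing Implicit Defensive.

Local Open Scope classical_set_scope.
Local Open Scope ring_scope.

(* The library's norm on ['rV[R]_N] is the sup norm. It induces the usual
   topology, so the library's limits and derivatives are the usual ones, but
   lengths and balls must be taken with the Euclidean norm. *)
Definition enorm (R : realType) (N : nat) (x : 'rV[R]_N) : R :=
  Num.sqrt (\sum_(i < N) x ord0 i ^+ 2).

Definition eball (R : realType) (N : nat) (r : R) : set 'rV[R]_N :=
  [set x | enorm x < r].

Definition partial (R : realType) (N : nat) (i : 'I_N) (f : 'rV[R]_N -> R) :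
    'rV[R]_N -> R :=
  fun x => 'D_(delta_mx ord0 i) f x.

Definition gradient (R : realType) (N : nat) (f : 'rV[R]_N -> R)
    (x : 'rV[R]_N) : 'rV[R]_N :=
  \row_(i < N) partial i f x.

Definition laplacian (R : realType) (N : nat) (f : 'rV[R]_N -> R)
    (x : 'rV[R]_N) : R :=
  \sum_(i < N) partial i (partial i f) x.

(* Meant for open [A]: existence of a derivative at a point, its value, and
   continuity at a point only involve the values of [f] near that point, so the
   values of [f] outside [A] play no role. *)
Fixpoint Ck_on (R : realType) (N k : nat) (A : set 'rV[R]_N)
    (f : 'rV[R]_N -> R) : Prop :=
  (forall x, A x -> {for x, continuous f}) /\
  match k with
  | 0%N => True
  | k'.+1 => forall i : 'I_N,
      (forall x, A x -> derivable f x (delta_mx ord0 i)) /\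
      Ck_on k' A (partial i f)
  end.

(* As [powR 0 0 = 1], the gradient factor is identically [1] when [q = 0], even
   at critical points of [u]. *)
Definition positive_solution (R : realType) (N : nat) (p q : R)
    (A : set 'rV[R]_N) (u : 'rV[R]_N -> R) : Prop :=
  [/\ Ck_on 2 A u,
      forall x, A x -> 0 < u x &
      forall x, A x -> - laplacian u x = u x `^ p * enorm (gradient u x) `^ q].

(* The case split is needed because [x / 0 = 0] in the library. *)
Definition exponent_bound (R : realType) (N : nat) (p : R) : \bar R :=
  if p == 0 then +oo%E else ((p + 1) ^+ 2 / (p * (N%:R - 1)))%:E.

(* Main.v *)
Require Import Defs.
From HB Require Import structures.
From mathcomp Require Import all_boot all_order all_algebra.
From mathcomp Require Import all_classical all_reals all_analysis.
From mathcomp Require Import ring lra.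
Import Order.TTheory GRing.Theory Num.Theory.
Import numFieldNormedType.Exports.

Local Open Scope classical_set_scope.
Local Open Scope ring_scope.

(** The proof is Bernstein's method, applied to a weighted power of the gradient.

    Put [n = N - 1], [z = |grad u| ^ 2], [X = z / u], [f = u ^ p z ^ (q / 2)], so
    that the Laplacian of [u] is [- f], and let [a = 1 - mu]. Then
    [|grad u ^ a| ^ 2 = a ^ 2 P] with [P = u ^ (- 2 mu) z]. Consider a maximum
    point [x0] of [eta ^ k P] in the ball of radius [rho = r / 2], where
    [eta = rho ^ 2 - |x| ^ 2]. Up to terms due to the cutoff, the first order
    condition at [x0] says that [grad u] is an eigenvector of the Hessian [H] of
    [u], with eigenvalue [mu X]. Hence [|H| ^ 2] is at least
    [(mu X) ^ 2 + (f + mu X) ^ 2 / n] ([trace_bessel]). Through Bochner's formula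
    the second order condition then reads
      [A X ^ 2 + B X f + f ^ 2 / n <= cutoff terms],
    with [A] and [B] depending on [mu], [n], [p], [q] ([bernstein_pointwise]). The
    hypotheses on the exponents provide a [mu] in [(0, 1)] for which this form is
    coercive on the quadrant: with [mu = n / (n + s ^ 2 - 1)] the condition is
    [n (p + q - 1) < 2 + 2 s - p (s ^ 2 - 1)] for some [s > 1]
    ([exists_exponent], [exponent_identities]). So [X ^ 2 + f ^ 2] is at most a
    multiple of [z rho ^ 2 / eta ^ 2] at [x0] ([interior_max_bound]). Since
    [z P ^ (1 / d)] is at most [X ^ 2 + f ^ 2], where [- d] is the exponent of the
    radius in the theorem ([log_interpolation]), this bounds
    [eta ^ 2 P ^ (1 / d)] by a multiple of [rho ^ 2] at [x0], and comparing the
    values of [eta ^ k P] at [x0] and at the centre gives the estimate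
    ([centre_bound]).

    Bochner's formula involves third derivatives of [u], whereas [u] is only of
    class C^2. Elliptic regularity is avoided by replacing [z] with the sum of the
    squares of difference quotients of [u] with step [e], which is of class C^2.
    Its Laplacian involves only second derivatives of [u] and difference quotients
    of the Laplacian [- f]; as [f] is of class C^1 where the gradient does not
    vanish, everything converges as [e] tends to [0]. The approximation is within
    [O(e)] of [z], and a quartic penalty forces its maxima to converge to [x0]
    ([penalised_max]), so the conclusion of Bochner's formula holds at [x0] in the
    limit ([log_gradient_max]). *)

Set Implicit Arguments.
Unset Strict Implicit.
Unset Printing Implicit Defensive.

(** * Derivatives along a vector *)

(** Restriction to a line reduces derivatives along a vector to derivatives of
    functions of one real variable, to which the chain rule and the mean value
    theorem apply. *)
Lemma is_derive_line (R : realType) (V : normedModType R) (f : V -> R)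
    (x v : V) (t d : R) :
  is_derive t 1 (fun s : R => f (s *: v + x)) d <->
  is_derive (t *: v + x) v f d.
Proof.
have E : (fun h : R => h^-1 *:
      (((fun s : R => f (s *: v + x)) \o shift t) (h *: 1) - f (t *: v + x))) =
    (fun h : R => h^-1 *:
      ((f \o shift (t *: v + x)) (h *: v) - f (t *: v + x))).
  by apply/funext => h /=; rewrite [h%:A]mulr1 scalerDl addrA.
split=> -[H1 H2]; split.
- by rewrite /derivable -E; exact: H1.
- by rewrite /derive -E; exact: H2.
- by rewrite /derivable E; exact: H1.
- by rewrite /derive E; exact: H2.
Qed.

Section PointwiseRules.
Context (R : realType) (V : normedModType R).
Implicit Types (f g : V -> R) (x v : V) (a b : R).

Lemma is_deriveDp f g x v a b : is_derive x v f a -> is_derive x v g b ->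
  is_derive x v (fun y => f y + g y) (a + b).
Proof. exact: is_deriveD. Qed.

Lemma is_deriveBp f g x v a b : is_derive x v f a -> is_derive x v g b ->
  is_derive x v (fun y => f y - g y) (a - b).
Proof. exact: is_deriveB. Qed.

Lemma is_deriveMp f g x v a b : is_derive x v f a -> is_derive x v g b ->
  is_derive x v (fun y => f y * g y) (a * g x + f x * b).
Proof.
move=> fa gb; have := is_deriveM fa gb.
by rewrite addrC /GRing.scale /= [g x * a]mulrC.
Qed.

Lemma is_deriveZp f x v c a : is_derive x v f a ->
  is_derive x v (fun y => c * f y) (c * a).
Proof. exact: is_deriveZ. Qed.

Lemma is_derive_sump n (h : 'I_n -> V -> R) x v (d : 'I_n -> R) :
  (forall i, is_derive x v (h i) (d i)) ->
  is_derive x v (fun y => \sum_(i < n) h i y) (\sum_(i < n) d i).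
Proof.
move=> H; rewrite (_ : (fun y => _) = \sum_(i < n) h i).
  exact: is_derive_sum.
by apply/funext => y; rewrite fct_sumE.
Qed.

Lemma is_deriveXp f x v a k : is_derive x v f a ->
  is_derive x v (fun y => f y ^+ k.+1) (k.+1%:R * f x ^+ k * a).
Proof.
move=> fa; rewrite (_ : (fun y => _) = f ^+ k.+1); last first.
  by apply/funext => y; rewrite exprfctE.
exact: is_deriveX.
Qed.

Lemma is_derive_compp (g : R -> R) f x v a b :
  is_derive (f x) 1 g b -> is_derive x v f a ->
  is_derive x v (fun y => g (f y)) (b * a).
Proof.
move=> gb fa.
have X : 0 *: v + x = x by rewrite scale0r add0r.
have := (is_derive_line (fun y => g (f y)) x v 0 (b * a)).1.
rewrite X; apply.
apply: (@is_derive1_comp R g (fun s : R => f (s *: v + x)) 0 b a).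
  by rewrite X.
by apply/is_derive_line; rewrite X.
Qed.

Lemma is_derive_lnp f x v a : 0 < f x -> is_derive x v f a ->
  is_derive x v (fun y => ln (f y)) (a / f x).
Proof.
move=> f0 fa; rewrite mulrC; apply: is_derive_compp => //.
exact: is_derive1_ln.
Qed.

Lemma is_derive_expRp f x v a : is_derive x v f a ->
  is_derive x v (fun y => expR (f y)) (expR (f x) * a).
Proof. by apply: is_derive_compp; exact: is_derive_expR. Qed.

Lemma is_derive_divp f g x v a b : g x != 0 ->
  is_derive x v f a -> is_derive x v g b ->
  is_derive x v (fun y => f y / g y) (a / g x - f x * b / g x ^+ 2).
Proof.
move=> g0 fa gb.
have gV : is_derive x v (fun y => (g y)^-1) (- (b / g x ^+ 2)).
  have [dg <-] := gb; split; first exact: derivableV.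
  by rewrite deriveV // scaleNr; congr (- _); rewrite /GRing.scale /= mulrC.
have := is_deriveMp fa gV.
by rewrite mulrN mulrA.
Qed.

Lemma is_derive_shiftp f x v w a : is_derive (w + x) v f a ->
  is_derive x v (fun y => f (w + y)) a.
Proof.
have E : (fun h : R => h^-1 *:
      (((fun y => f (w + y)) \o shift x) (h *: v) - f (w + x))) =
    (fun h : R => h^-1 *:
      ((f \o shift (w + x)) (h *: v) - f (w + x))).
  by apply/funext => h /=; rewrite addrCA.
move=> -[H1 H2]; split.
- by rewrite /derivable E; exact: H1.
- by rewrite /derive E; exact: H2.
Qed.

End PointwiseRules.

(** If [f''] were positive at [0], [f'] would be positive on some [(0, e)], and
    [f] would exceed [f 0] there by the mean value theorem. *)
Lemma second_derivative_test (R : realType) (f g : R -> R) (k r : R) :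
  0 < r ->
  (forall t : R, `|t| < r -> is_derive t 1 f (g t)) ->
  (forall t : R, `|t| < r -> f t <= f 0) ->
  is_derive (0 : R) 1 g k ->
  g 0 = 0 /\ k <= 0.
Proof.
move=> r0 fg fmax gk.
have I (t : R) : t \in `](- r), r[ -> `|t| < r by rewrite in_itv /= -ltr_norml.
have g0 : g 0 = 0.
  have d0 : is_derive (0 : R) 1 f 0.
    apply: (@derive1_at_max R f (- r) r 0).
    - by rewrite ge0_cp // ltW.
    - by move=> t /I /fg [].
    - by rewrite in_itv /= oppr_lt0 r0.
    - by move=> t /I; exact: fmax.
  have [_ <-] : is_derive (0 : R) 1 f (g 0) by apply: fg; rewrite normr0.
  by have [_ ->] := d0.
split=> //; rewrite leNgt; apply/negP => k0.
have [gd gv] := gk.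
have gc : (fun h : R => h^-1 *: ((g \o shift 0) h%:A - g 0)) @ 0^' --> k.
  by rewrite -gv; exact: gd.
have /= : \forall h \near 0^', 0 < h^-1 *: ((g \o shift 0) h%:A - g 0).
  exact: cvgr_gt gc _ k0.
case=> e /= e0 ge.
pose m := Num.min e r.
have m0 : 0 < m by rewrite lt_min e0.
have m20 : 0 < m / 2 by rewrite divr_gt0.
have m2m : m / 2 < m by lra.
have me : m <= e by rewrite ge_min lexx.
have mr : m <= r by rewrite ge_min lexx orbT.
have dI (t : R) : t \in `[0, m / 2]%R -> is_derive t 1 f (g t).
  rewrite in_itv /= => /andP[t0 t1]; apply: fg; rewrite ger0_norm //.
  by apply: le_lt_trans t1 _; apply: lt_le_trans mr.
have fi (t : R) : t \in `]0, (m / 2)[%R -> is_derive t 1 f (g t).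
  by move=> tI; apply: dI; apply: subset_itv_oo_cc tI.
have fc : {within `[0, m / 2], continuous f}.
  by apply: derivable_within_continuous => t /dI [].
have [c + E] := MVT m20 fi fc.
rewrite in_itv /= => /andP[c0 c1].
have gc0 : 0 < g c.
  have := ge c; rewrite /= sub0r normrN gtr0_norm // g0 subr0 addr0.
  rewrite [c%:A]mulr1 /GRing.scale /= pmulr_rgt0 ?invr_gt0 //; apply.
    by apply: lt_trans c1 _; apply: lt_le_trans me.
  by rewrite gt_eqF.
have : f (m / 2) <= f 0.
  by apply: fmax; rewrite gtr0_norm //; apply: lt_le_trans mr.
by rewrite leNgt -subr_gt0 E subr0 mulr_gt0.
Qed.

Section PointwiseLimits.
Context {R : realType} {T : Type} {F : set_system T} {FF : Filter F}.
Implicit Types (f g : T -> R) (a : R).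

Lemma cvg_sump n (f : 'I_n -> T -> R) (l : 'I_n -> R) :
  (forall i, f i x @[x --> F] --> l i) ->
  \sum_(i < n) f i x @[x --> F] --> \sum_(i < n) l i.
Proof. by move=> H; apply: cvg_big => //; exact: add_continuous. Qed.

Lemma cvgXp f a k : f x @[x --> F] --> a -> f x ^+ k @[x --> F] --> a ^+ k.
Proof. by move=> fa; exact: (cvg_comp _ _ fa (@exprn_continuous R k a)). Qed.

Lemma cvg_lnp f a : 0 < a -> f x @[x --> F] --> a ->
  ln (f x) @[x --> F] --> ln a.
Proof. by move=> a0 fa; exact: (cvg_comp _ _ fa (continuous_ln a0)). Qed.

Lemma cvg_expRp f a : f x @[x --> F] --> a ->
  expR (f x) @[x --> F] --> expR a.
Proof. by move=> fa; exact: (cvg_comp _ _ fa (@continuous_expR R a)). Qed.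

End PointwiseLimits.

(** * Difference quotients as the step tends to zero *)

Section Coordinates.
Context (R : realType) (n : nat).
Implicit Types (x y v : 'rV[R]_n).

Definition basis (i : 'I_n) : 'rV[R]_n := delta_mx ord0 i.

Lemma coord_le_norm x i : `|x ord0 i| <= `|x|.
Proof.
have -> : `|x| = mx_norm x by [].
rewrite mx_normrE.
by rewrite (le_bigmax _ (fun i : 'I_1 * 'I_n => `|x i.1 i.2|) (ord0, i)).
Qed.

Lemma norm_le_coord x r : 0 <= r -> (forall i, `|x ord0 i| <= r) -> `|x| <= r.
Proof.
move=> r0 H; have -> : `|x| = mx_norm x by [].
rewrite mx_normrE; apply: bigmax_le => // -[a i] _ /=.
by rewrite (ord1 a).
Qed.

Lemma norm_lt_coord x r : 0 < r -> (forall i, `|x ord0 i| < r) -> `|x| < r.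
Proof.
move=> r0 H; have -> : `|x| = mx_norm x by [].
rewrite mx_normrE; apply: bigmax_lt => // -[a i] _ /=.
by rewrite (ord1 a).
Qed.

Lemma basisE i j : basis i ord0 j = (j == i)%:R.
Proof. by rewrite mxE eqxx. Qed.

Lemma norm_basis_le1 i : `|basis i| <= 1.
Proof.
apply: norm_le_coord => // j; rewrite basisE.
by case: eqP; rewrite ?normr1 ?normr0.
Qed.

Lemma is_derive_coord x v j :
  is_derive x v (fun y : 'rV[R]_n => y ord0 j) (v ord0 j).
Proof.
have X : 0 *: v + x = x by rewrite scale0r add0r.
rewrite -[in is_derive x]X; apply/is_derive_line.
rewrite (_ : (fun _ => _) = (fun s : R => v ord0 j * s + x ord0 j)); last first.
  by apply/funext => s; rewrite !mxE mulrC.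
rewrite -[X in is_derive _ _ _ X]addr0.
apply: is_deriveDp.
rewrite -[X in is_derive _ _ _ X]mulr1.
by apply: is_deriveZp; exact: is_derive_id.
Qed.

Lemma sum_basis (F : 'I_n -> R) i : \sum_(j < n) F j * (j == i)%:R = F i.
Proof.
rewrite (bigD1 i) //= eqxx mulr1 big1 ?addr0 // => j /negPf ->.
by rewrite mulr0.
Qed.

Lemma continuous_coord i : continuous (fun y : 'rV[R]_n => y ord0 i).
Proof. by move=> y; exact: coord_continuous. Qed.

End Coordinates.

(** The joint limit in which a step decreases to [0] while a base point tends to
    [x0]; uniformity of difference quotients near [x0] is expressed by it. *)
Definition approach (R : realType) (V : normedModType R) (x0 : V) :
  set_system (R * V) := filter_prod (0^'+) (nbhs x0).

#[global] Instance approach_filter (R : realType) (V : normedModType R)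
  (x0 : V) : ProperFilter (approach x0).
Proof. exact: filter_prod_proper. Qed.

Section Approach.
Context (R : realType) (V : normedModType R).
Implicit Types (P : R * V -> Prop).

Lemma near_approach (x0 : V) P : (\forall p \near approach x0, P p) <->
  exists2 r : R, 0 < r & forall e x, 0 < e < r -> `|x - x0| < r -> P (e, x).
Proof.
split.
  case=> -[A B] /= [A0 B0] AB.
  case: A0 => r1 /= r10 A1.
  move/nbhs_normP : B0 => -[r2 /= r20 B1].
  exists (Num.min r1 r2); first by rewrite lt_min r10.
  move=> e x /andP[e0 er] xr; apply: AB; split => /=.
    apply: A1 => //=; rewrite sub0r normrN gtr0_norm //.
    by apply: lt_le_trans er _; rewrite ge_min lexx.
  apply: B1 => /=; rewrite distrC; apply: lt_le_trans xr _.
  by rewrite ge_min lexx orbT.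
case=> r r0 H.
exists ([set e | 0 < e < r], [set x | `|x - x0| < r]) => /=; last first.
  by case=> e x /= [e0r xr]; exact: H.
split.
  near=> e; apply/andP; split; near: e; first exact: nbhs_right_gt.
  exact: nbhs_right_lt.
by apply/nbhs_normP; exists r => //= y /=; rewrite distrC.
Unshelve. all: by end_near. Qed.

Lemma cvg_approach_snd (x0 : V) (f : V -> R) :
  {for x0, continuous f} -> f p.2 @[p --> approach x0] --> f x0.
Proof.
by move=> fc; apply: (cvg_comp _ _ (@cvg_snd _ _ (0^'+) (nbhs x0) _)) fc.
Qed.

Lemma near_approach_snd (x0 : V) (P : V -> Prop) :
  (\forall x \near x0, P x) -> \forall p \near approach x0, P p.2.
Proof. exact: (@cvg_snd _ _ (0^'+) (nbhs x0) _). Qed.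

Lemma near_approach_pos (x0 : V) : \forall p \near approach x0, 0 < p.1.
Proof. by apply/near_approach; exists 1 => // e x /andP[]. Qed.

Lemma near_approach_and (x0 : V) P (Q : R * V -> Prop) :
  (\forall p \near approach x0, P p) -> (\forall p \near approach x0, Q p) ->
  \forall p \near approach x0, P p /\ Q p.
Proof. by move=> HP HQ; exact: filterI. Qed.

Definition diffquot (v : V) (e : R) (f : V -> R) (x : V) : R :=
  (f (e *: v + x) - f x) / e.

Lemma is_derive_diffquot (v w x : V) (e : R) (f df : V -> R) :
  is_derive x w f (df x) -> is_derive (e *: v + x) w f (df (e *: v + x)) ->
  is_derive x w (diffquot v e f) (diffquot v e df x).
Proof.
move=> H1 H2; rewrite /diffquot.
rewrite (_ : (fun x => _) = (fun x => e^-1 * (f (e *: v + x) - f x))); last first.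
  by apply/funext => y; rewrite mulrC.
rewrite mulrC; apply: is_deriveZp; apply: is_deriveBp => //.
exact: is_derive_shiftp.
Qed.

Lemma diffquot_mean (v x : V) (e : R) (f df : V -> R) : 0 < e ->
  (forall s, 0 <= s <= e -> is_derive (s *: v + x) v f (df (s *: v + x))) ->
  exists2 s, 0 < s < e & diffquot v e f x = df (s *: v + x).
Proof.
move=> e0 H.
have D (t : R) : t \in `[0, e]%R ->
    is_derive t 1 (fun s : R => f (s *: v + x)) (df (t *: v + x)).
  by rewrite in_itv => /H ?; apply/is_derive_line.
have fc : {within `[0, e], continuous (fun s : R => f (s *: v + x))}.
  by apply: derivable_within_continuous => t /D [].
have fi (t : R) : t \in `]0, e[%R ->
    is_derive t 1 (fun s : R => f (s *: v + x)) (df (t *: v + x)).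
  by move=> tI; apply: D; apply: subset_itv_oo_cc tI.
have [c + E] := MVT e0 fi fc.
rewrite in_itv /= => ce; exists c => //.
rewrite /diffquot; move: E; rewrite scale0r add0r => ->.
by rewrite subr0 mulfK // gt_eqF.
Qed.

Lemma near_approach_segment (x0 v : V) (P : V -> Prop) : `|v| <= 1 ->
  (\forall x \near x0, P x) ->
  \forall p \near approach x0, forall s, 0 <= s <= p.1 -> P (s *: v + p.2).
Proof.
move=> v1 /nbhs_normP[r /= r0 H]; apply/near_approach.
exists (r / 2); first by rewrite divr_gt0.
move=> e x /= /andP[e0 er] xr s /andP[s0 se]; apply: H => /=.
rewrite distrC -addrA; apply: le_lt_trans (ler_normD _ _) _.
rewrite normrZ ger0_norm // [ltRHS](splitr r); apply: ltr_leD.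
  apply: le_lt_trans er; apply: le_trans se.
  by rewrite ler_piMr.
exact: ltW.
Qed.

(** By the mean value theorem the quotient is a value of [df] at a point of the
    segment from [x] to [e *: v + x], which shrinks to [x0]. *)
Lemma diffquot_cvg (x0 v : V) (f df : V -> R) : `|v| <= 1 ->
  (\forall x \near x0, is_derive x v f (df x)) -> {for x0, continuous df} ->
  diffquot v p.1 f p.2 @[p --> approach x0] --> df x0.
Proof.
move=> v1 fd dfc; apply/cvgrPdist_le => e e0.
have H : \forall x \near x0, is_derive x v f (df x) /\ `|df x0 - df x| <= e.
  by apply: filterI => //; move/cvgrPdist_le: dfc; exact.
near=> p.
have p0 : 0 < p.1 by near: p; exact: near_approach_pos.
have Hp : forall s, 0 <= s <= p.1 ->
    is_derive (s *: v + p.2) v f (df (s *: v + p.2)) /\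
    `|df x0 - df (s *: v + p.2)| <= e.
  by near: p; exact: near_approach_segment v1 H.
have [|s /andP[s0 se] ->] := @diffquot_mean v p.2 p.1 f df p0.
  by move=> s /Hp[].
by have [|] := Hp s; first by rewrite !ltW.
Unshelve. all: by end_near. Qed.

(** A linear rate, uniform near [x0], is what the penalisation of
    [frequent_critical_points] can absorb; it comes from a second application of
    the mean value theorem, [ddf] being bounded near [x0]. *)
Lemma diffquot_rate (x0 v : V) (f df ddf : V -> R) : `|v| <= 1 ->
  (\forall x \near x0, is_derive x v f (df x)) ->
  (\forall x \near x0, is_derive x v df (ddf x)) ->
  {for x0, continuous ddf} ->
  exists2 M, 0 <= M &
    \forall p \near approach x0, `|diffquot v p.1 f p.2 - df p.2| <= M * p.1.
Proof.
move=> v1 fd dfd ddfc; exists (`|ddf x0| + 1); first by rewrite addr_ge0.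
have B : \forall x \near x0, `|ddf x| <= `|ddf x0| + 1.
  move/cvgrPdist_le : ddfc => /(_ 1 ltr01); apply: filterS => x Hx.
  rewrite -[ddf x](subKr (ddf x0)) (le_trans (ler_normB _ _)) //.
  by rewrite lerD2l.
have H : \forall x \near x0,
    [/\ is_derive x v f (df x), is_derive x v df (ddf x)
      & `|ddf x| <= `|ddf x0| + 1].
  by near do split.
have C := near_approach_segment v1 H.
move: (near_approach_pos x0) C; apply: (@filterS2 _ (approach x0)) => p p0 Hp.
have [|s /andP[s0 se] ->] := @diffquot_mean v p.2 p.1 f df p0.
  by move=> s /Hp[].
have [|t /andP[t0 ts] E] := @diffquot_mean v p.2 s df ddf s0.
  move=> t /andP[t0 ts]; have [|_ //] := Hp t.
  by rewrite t0 /= (le_trans ts) // ltW.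
have -> : df (s *: v + p.2) - df p.2 = ddf (t *: v + p.2) * s.
  by rewrite -E /diffquot divfK // gt_eqF.
rewrite normrM [`|s|]gtr0_norm //.
have [|_ _ Ht] := Hp t; first by rewrite ltW //= (le_trans (ltW ts)) // ltW.
by apply: ler_pM => //; exact: ltW.
Unshelve. all: by end_near. Qed.

End Approach.

Lemma frequently_cvg_le0 (R : realType) (T : Type) (F : set_system T)
    {FF : Filter F} (A : T -> R) (a : R) :
  A @ F --> a ->
  (forall P : T -> Prop, (\forall p \near F, P p) -> exists2 p, P p & A p <= 0) ->
  a <= 0.
Proof.
move=> Aa H; rewrite leNgt; apply/negP => a0.
have [p] := H _ (cvgr_gt a Aa 0 a0).
by rewrite ltNge => /negP.
Qed.

(** * A maximum principle for limits of smooth functions *)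

Section PenalisedMaximum.
Context (R : realType) (n : nat).
Implicit Types (x : 'rV[R]_n).

(** A penalty whose gradient and Hessian both vanish at its minimum [x0], so
    that it leaves no trace in the limit. *)
Definition quartic (x0 x : 'rV[R]_n) : R :=
  \sum_(j < n) (x ord0 j - x0 ord0 j) ^+ 4.

Lemma is_derive_power_coord k (x0 x : 'rV[R]_n) (i j : 'I_n) :
  is_derive x (basis R i) (fun y : 'rV[R]_n => (y ord0 j - x0 ord0 j) ^+ k.+1)
    ((k.+1)%:R * (x ord0 j - x0 ord0 j) ^+ k * (j == i)%:R).
Proof.
apply: (@is_deriveXp _ _ (fun y : 'rV[R]_n => y ord0 j - x0 ord0 j)).
rewrite -[X in is_derive _ _ _ X]subr0.
apply: is_deriveBp.
by rewrite -basisE; exact: is_derive_coord.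
Qed.

Lemma is_derive_quartic (x0 x : 'rV[R]_n) (i : 'I_n) :
  is_derive x (basis R i) (quartic x0) (4 * (x ord0 i - x0 ord0 i) ^+ 3).
Proof.
rewrite -(sum_basis (fun j => 4 * (x ord0 j - x0 ord0 j) ^+ 3) i).
by apply: is_derive_sump => j; exact: is_derive_power_coord.
Qed.

Lemma continuous_quartic (x0 : 'rV[R]_n) : continuous (quartic x0).
Proof.
move=> x; rewrite /quartic.
apply: (@cvg_sump R _ (nbhs x)) => j.
apply: (@cvgXp R _ (nbhs x)).
by apply: cvgB; [exact: continuous_coord|exact: cvg_cst].
Qed.

Lemma quartic_self (x0 : 'rV[R]_n) : quartic x0 x0 = 0.
Proof. by rewrite /quartic big1 // => i _; rewrite subrr expr0n. Qed.

Lemma norm_lt_quartic (x0 x : 'rV[R]_n) (s : R) :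
  0 < s -> quartic x0 x < s ^+ 4 -> `|x - x0| < s.
Proof.
move=> s0 qs; apply: norm_lt_coord => // i; rewrite !mxE.
suff : `|x ord0 i - x0 ord0 i| ^+ 4 < s ^+ 4.
  by rewrite ltr_pXn2r // nnegrE ltW.
rewrite -normrX ger0_norm ?exprn_even_ge0 //.
apply: le_lt_trans qs; rewrite /quartic (bigD1 i) //= lerDl.
by apply: sumr_ge0 => j _; rewrite exprn_even_ge0.
Qed.

Lemma compact_box (x0 : 'rV[R]_n) (s : R) : 0 <= s ->
  compact [set x : 'rV[R]_n | `|x - x0| <= s].
Proof.
move=> s0.
rewrite (_ : mkset _ = [set v : 'rV[R]_n | forall i,
    `[x0 ord0 i - s, x0 ord0 i + s]%classic (v ord0 i)]).
  apply: (@rV_compact R n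
    (fun i => `[x0 ord0 i - s, x0 ord0 i + s]%classic)) => i.
  exact: segment_compact.
apply/seteqP; split => x /=.
  move=> xs i; rewrite in_itv /= -ler_distl.
  by have := le_trans (coord_le_norm (x - x0) i) xs; rewrite !mxE.
move=> xs; apply: norm_le_coord => // i; rewrite !mxE ler_distl.
by have := xs i; rewrite in_itv.
Qed.

(** [L e] approximates [f] up to [M * e] but need not be maximal at [x0].
    Subtracting [quartic x0] makes [x0] a strict maximum of the limit: at a
    maximum [x] of [L e - quartic x0] on a small closed box,
    [quartic x0 x <= 2 * M * e], so that for small [e] this maximum is interior,
    and it tends to [x0] with [e]. *)
Lemma frequent_critical_points (x0 : 'rV[R]_n) (f : 'rV[R]_n -> R)
    (L : R -> 'rV[R]_n -> R) (G K : 'I_n -> R * 'rV[R]_n -> R) (M : R) :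
  (\forall x \near x0, f x <= f x0) ->
  (\forall p \near approach x0, `|L p.1 p.2 - f p.2| <= M * p.1) ->
  (\forall p \near approach x0, {for p.2, continuous (L p.1)}) ->
  (\forall p \near approach x0,
    forall i, is_derive p.2 (basis R i) (L p.1) (G i p)) ->
  (\forall p \near approach x0, forall i,
    is_derive p.2 (basis R i) (fun x => G i (p.1, x)) (K i p)) ->
  forall P : R * 'rV[R]_n -> Prop, (\forall p \near approach x0, P p) ->
  exists2 p, P p & forall i,
    G i p = 4 * (p.2 ord0 i - x0 ord0 i) ^+ 3 /\
    K i p <= 12 * (p.2 ord0 i - x0 ord0 i) ^+ 2.
Proof.
move=> fmax LM Lc LG GK P HP.
have H : \forall p \near approach x0,
    [/\ f p.2 <= f x0 /\ `|L p.1 p.2 - f p.2| <= M * p.1,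
       {for p.2, continuous (L p.1)},
       forall i, is_derive p.2 (basis R i) (L p.1) (G i p),
       forall i, is_derive p.2 (basis R i) (fun x => G i (p.1, x)) (K i p)
     & P p].
  have fmax' := near_approach_snd fmax.
  by near=> p; split; [split|..]; near: p.
case/near_approach : H => r r0 H.
(* The box of radius [s] has to lie inside the neighbourhood of radius [r]. *)
pose s := r / 2.
have s0 : 0 < s by rewrite divr_gt0.
have sr : s < r by rewrite /s ltr_pdivrMr // mulrDr mulr1 ltrDl.
have [e [e0 er Me]] : exists e, [/\ 0 < e, e < r & 2 * (M * e) < s ^+ 4].
  have t0 : 0 < s ^+ 4 / (4 * (`|M| + 1)).
    by rewrite divr_gt0 ?exprn_gt0 // mulr_gt0 // ltr_wpDl.
  exists (Num.min s (s ^+ 4 / (4 * (`|M| + 1)))).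
  have m0 : 0 < Num.min s (s ^+ 4 / (4 * (`|M| + 1))) by rewrite lt_min s0.
  split => //; first by rewrite (le_lt_trans _ sr) // ge_min lexx.
  apply: (@le_lt_trans _ _
    (2 * ((`|M| + 1) * (s ^+ 4 / (4 * (`|M| + 1)))))).
    rewrite ler_pM2l //; apply: (@le_trans _ _
      ((`|M| + 1) * (Num.min s (s ^+ 4 / (4 * (`|M| + 1)))))).
      by rewrite ler_pM2r // (le_trans (ler_norm _)) // lerDl.
    by rewrite ler_pM2l ?ltr_wpDl // ge_min lexx orbT.
  have -> : 2 * ((`|M| + 1) * (s ^+ 4 / (4 * (`|M| + 1)))) = s ^+ 4 / 2.
    by field; rewrite gt_eqF // ltr_wpDl.
  by rewrite ltr_pdivrMr // mulrDr mulr1 ltrDl exprn_gt0.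
have e0r : 0 < e < r by rewrite e0.
pose h x := L e x - quartic x0 x.
pose B := [set x : 'rV[R]_n | `|x - x0| <= s].
have Br x : B x -> `|x - x0| < r by move=> /le_lt_trans; exact.
have Bx0 : B x0 by rewrite /B /= subrr normr0 ltW.
have hc : {within B, continuous h}.
  apply: continuous_in_subspaceT => x; rewrite inE => /Br xr.
  have [_ Lx _ _ _] := H e x e0r xr.
  exact: (continuousB Lx (@continuous_quartic x0 x)).
have [x xB hmax] : exists2 x, x \in B & forall t, t \in B -> h t <= h x.
  by apply: EVT_max_rV => //; [exists x0|exact: compact_box (ltW s0)].
have {}xB : B x by rewrite inE in xB.
have xs : `|x - x0| < s.
  apply: norm_lt_quartic => //; apply: le_lt_trans Me.
  have := hmax x0; rewrite inE => /(_ Bx0); rewrite /h quartic_self subr0.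
  have [[_ A1] _ _ _ _] := H e x0 e0r (Br _ Bx0).
  have [[A2 A3] _ _ _ _] := H e x e0r (Br _ xB).
  move: A1 A2 A3; rewrite /= !ler_norml => /andP[a1 a2] a3 /andP[a4 a5].
  by move=> a6; lra.
have [_ _ _ _ Px] := H e x e0r (Br _ xB).
exists (e, x) => // i /=.
pose rho := s - `|x - x0|.
have rho0 : 0 < rho by rewrite subr_gt0.
have Bt (t : R) : `|t| < rho -> B (t *: basis R i + x).
  move=> tr; rewrite /B /= -addrA; apply: le_trans (ler_normD _ _) _.
  rewrite -lerBrDr; apply: ltW; apply: le_lt_trans tr.
  by rewrite normrZ ler_piMr // norm_basis_le1.
pose g (t : R) := G i (e, t *: basis R i + x) -
  4 * ((t *: basis R i + x) ord0 i - x0 ord0 i) ^+ 3.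
have X : 0 *: basis R i + x = x by rewrite scale0r add0r.
have dh (t : R) : `|t| < rho ->
    is_derive t 1 (fun t : R => h (t *: basis R i + x)) (g t).
  move=> /Bt/Br tr; apply/is_derive_line; apply: is_deriveBp.
    by have [_ _ D _ _] := H e _ e0r tr; exact: D.
  exact: is_derive_quartic.
have hm (t : R) : `|t| < rho ->
    h (t *: basis R i + x) <= h (0 *: basis R i + x).
  by move=> /Bt tr; rewrite X; apply: hmax; rewrite inE.
have dg : is_derive (0 : R) 1 g (K i (e, x) - 12 * (x ord0 i - x0 ord0 i) ^+ 2).
  apply: (is_derive_line (fun y => G i (e, y) - 4 * (y ord0 i - x0 ord0 i) ^+ 3)
    x (basis R i) 0 _).2.
  rewrite X; apply: is_deriveBp.
    by have [_ _ _ D _] := H e x e0r (Br _ xB); exact: D.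
  have := is_deriveZp 4 (is_derive_power_coord 2 x0 x i i).
  by rewrite eqxx mulr1 mulrA -natrM.
have [] := second_derivative_test rho0 dh hm dg.
by rewrite /g X => /eqP; rewrite subr_eq0 subr_le0 => /eqP.
Unshelve. all: by end_near. Qed.

(** A maximum principle for a function [f] that need not be twice
    differentiable: if [f] is approximated by functions whose gradients and
    Laplacians converge to [g] and [k], then [g] and [k] satisfy the first and
    second order conditions at a maximum of [f]. *)
Lemma penalised_max (x0 : 'rV[R]_n) (f : 'rV[R]_n -> R)
    (L : R -> 'rV[R]_n -> R) (G K : 'I_n -> R * 'rV[R]_n -> R) (M : R)
    (g : 'I_n -> R) (k : R) :
  (\forall x \near x0, f x <= f x0) ->
  (\forall p \near approach x0, `|L p.1 p.2 - f p.2| <= M * p.1) ->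
  (\forall p \near approach x0, {for p.2, continuous (L p.1)}) ->
  (\forall p \near approach x0,
    forall i, is_derive p.2 (basis R i) (L p.1) (G i p)) ->
  (\forall p \near approach x0, forall i,
    is_derive p.2 (basis R i) (fun x => G i (p.1, x)) (K i p)) ->
  (forall i, G i p @[p --> approach x0] --> g i) ->
  \sum_i K i p @[p --> approach x0] --> k ->
  (forall i, g i = 0) /\ k <= 0.
Proof.
move=> fmax LM Lc LG GK Gg Kk.
have crit := frequent_critical_points fmax LM Lc LG GK.
have c0 i m : ((p.2 : 'rV[R]_n) ord0 i - x0 ord0 i) ^+ m.+1
    @[p --> approach x0] --> (0 : R).
  have C : (p.2 : 'rV[R]_n) ord0 i - x0 ord0 i @[p --> approach x0] -->
      x0 ord0 i - x0 ord0 i.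
    apply: cvgB; last exact: cvg_cst.
    apply: (@cvg_approach_snd _ _ _ (fun y : 'rV[R]_n => y ord0 i)).
    exact: continuous_coord.
  by have := cvgXp (k := m.+1) C; rewrite subrr expr0n.
split=> [i|].
  have Gc : G i p - 4 * ((p.2 : 'rV[R]_n) ord0 i - x0 ord0 i) ^+ 3
      @[p --> approach x0]
      --> g i - 4 * 0.
    by apply: cvgB => //; apply: cvgM; [exact: cvg_cst|exact: c0].
  rewrite mulr0 subr0 in Gc.
  apply/eqP; rewrite eq_le; apply/andP; split.
    apply: frequently_cvg_le0 Gc _ => P /crit[p Pp /(_ i)[E _]].
    exists p => //; change (G i p - 4 * (p.2 ord0 i - x0 ord0 i) ^+ 3 <= 0).
    by rewrite E subrr.
  rewrite -oppr_le0; apply: frequently_cvg_le0 (cvgN Gc) _ => P.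
  move=> /crit[p Pp /(_ i)[E _]]; exists p => //.
  change (- (G i p - 4 * (p.2 ord0 i - x0 ord0 i) ^+ 3) <= 0).
  by rewrite E subrr oppr0.
have Kc : \sum_i K i p - \sum_i 12 * ((p.2 : 'rV[R]_n) ord0 i - x0 ord0 i) ^+ 2
    @[p --> approach x0] --> k - \sum_(i < n) 12 * 0.
  apply: cvgB => //; apply: cvg_sump => i.
  by apply: cvgM; [exact: cvg_cst|exact: c0].
rewrite [X in _ - X]big1 ?subr0 in Kc; last by move=> i _; rewrite mulr0.
apply: frequently_cvg_le0 Kc _ => P /crit[p Pp H].
exists p => //.
change (\sum_i K i p - \sum_i 12 * (p.2 ord0 i - x0 ord0 i) ^+ 2 <= 0).
rewrite subr_le0; apply: ler_sum => i _.
by have [_] := H i.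
Qed.

End PenalisedMaximum.

Section Rates.
Context (R : realType) (V : normedModType R) (x0 : V).
Implicit Types (A B : R * V -> R) (a : R).

(** The square of the discrete gradient inherits its rate of convergence from
    the difference quotients, and so does its logarithm where the gradient does
    not vanish. *)
Definition rate A B := exists2 M, 0 <= M &
  \forall p \near approach x0, `|A p - B p| <= M * p.1.

Lemma rate_sum n (A B : 'I_n -> R * V -> R) :
  (forall i, rate (A i) (B i)) ->
  rate (fun p => \sum_i A i p) (fun p => \sum_i B i p).
Proof.
move=> H.
have /choice[M MH] : forall i, exists M, 0 <= M /\
    \forall p \near approach x0, `|A i p - B i p| <= M * p.1.
  by move=> i; have [M] := H i; exists M.
exists (\sum_i M i); first by apply: sumr_ge0 => i _; have [] := MH i.
have C : \forall p \near approach x0, forall i, `|A i p - B i p| <= M i * p.1.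
  by apply: filter_forall => i; have [] := MH i.
apply: filterS C => p Hp.
rewrite -sumrB mulr_suml; apply: le_trans (ler_norm_sum _ _ _) _.
exact: ler_sum.
Qed.

Lemma rate_sqr A B a : A p @[p --> approach x0] --> a ->
  B p @[p --> approach x0] --> a -> rate A B ->
  rate (fun p => A p ^+ 2) (fun p => B p ^+ 2).
Proof.
move=> Aa Ba [M M0 MH]; exists (M * (2 * (`|a| + 1))).
  by rewrite !mulr_ge0 // addr_ge0.
have bound (C : R * V -> R) : C p @[p --> approach x0] --> a ->
    \forall p \near approach x0, `|C p| <= `|a| + 1.
  move/cvgrPdist_le => /(_ 1 ltr01); apply: filterS => p Hp.
  have -> : C p = a - (a - C p) by rewrite subKr.
  by apply: le_trans (ler_normB _ _) _; rewrite lerD2l.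
move: (near_approach_and (bound _ Aa) (bound _ Ba)) MH.
apply: (@filterS2 _ (approach x0)) => p [Ap Bp] Mp.
rewrite subr_sqr normrM mulrAC; apply: ler_pM => //.
apply: le_trans (ler_normD _ _) _.
by rewrite mulr_natl mulr2n lerD.
Qed.

Lemma ln_lipschitz (a b m : R) : 0 < m -> m <= a -> m <= b ->
  `|ln a - ln b| <= `|a - b| / m.
Proof.
move=> m0; wlog : a b / b <= a.
  move=> H ma mb; have [ba|ab] := leP b a; first exact: H.
  by rewrite distrC [`|a - b|]distrC; apply: H => //; exact: ltW.
move=> ba ma mb.
have b0 : 0 < b by exact: lt_le_trans mb.
have a0 : 0 < a by exact: lt_le_trans ma.
rewrite ger0_norm ?subr_ge0 ?ler_ln // ger0_norm ?subr_ge0 //.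
rewrite -ln_div ?posrE //.
apply: (@le_trans _ _ (a / b - 1)).
  rewrite lerBrDl; have := expR_ge1Dx (ln (a / b)).
  by rewrite lnK // posrE divr_gt0.
rewrite -[X in _ - X](@divff _ b) ?gt_eqF // -mulrBl.
by apply: ler_wpM2l; rewrite ?subr_ge0 // lef_pV2.
Qed.

Lemma rate_ln A B a : 0 < a -> A p @[p --> approach x0] --> a ->
  B p @[p --> approach x0] --> a -> rate A B ->
  rate (fun p => ln (A p)) (fun p => ln (B p)).
Proof.
move=> a0 Aa Ba [M M0 MH]; exists (M / (a / 2)).
  by rewrite divr_ge0 // ltW // divr_gt0.
have a20 : 0 < a / 2 by rewrite divr_gt0.
have a2 : a / 2 < a by rewrite ltr_pdivrMr // mulrDr mulr1 ltrDl.
have Al : \forall p \near approach x0, a / 2 < A p by exact: cvgr_gt Aa _ a2.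
have Bl : \forall p \near approach x0, a / 2 < B p by exact: cvgr_gt Ba _ a2.
move: (near_approach_and Al Bl) MH.
apply: (@filterS2 _ (approach x0)) => p [/ltW Ap /ltW Bp] Mp.
apply: le_trans (ln_lipschitz a20 Ap Bp) _.
by rewrite mulrAC ler_wpM2r // invr_ge0 ltW.
Qed.

End Rates.

(** * Bochner's formula at a maximum, without third derivatives *)

Section LogGradient.
Context (R : realType) (n : nat) (x0 : 'rV[R]_n).
Context (u F phi : 'rV[R]_n -> R) (u1 F1 phi1 phi2 : 'I_n -> 'rV[R]_n -> R)
  (u2 : 'I_n -> 'I_n -> 'rV[R]_n -> R).

Context (u_cont : \forall x \near x0, {for x, continuous u}).
Context (u_der : \forall x \near x0,
  forall i, is_derive x (basis R i) u (u1 i x)).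
Context (u1_cont : forall i, {for x0, continuous (u1 i)}).
Context (u1_der : \forall x \near x0,
  forall j i, is_derive x (basis R j) (u1 i) (u2 j i x)).
Context (u2_cont : forall j i, {for x0, continuous (u2 j i)}).
Context (lap_u : \forall x \near x0, \sum_i u2 i i x = F x).
Context (F_der : \forall x \near x0,
  forall i, is_derive x (basis R i) F (F1 i x)).
Context (F1_cont : forall i, {for x0, continuous (F1 i)}).
Context (phi_cont : \forall x \near x0, {for x, continuous phi}).
Context (phi_der : \forall x \near x0,
  forall i, is_derive x (basis R i) phi (phi1 i x)).
Context (phi1_der : \forall x \near x0,
  forall i, is_derive x (basis R i) (phi1 i) (phi2 i x)).
Context (phi1_cont : forall i, {for x0, continuous (phi1 i)}).
Context (phi2_cont : forall i, {for x0, continuous (phi2 i)}).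

Let z x := \sum_j u1 j x ^+ 2.
Context (z_gt0 : 0 < z x0).
Context (z_max : \forall x \near x0, ln (z x) + phi x <= ln (z x0) + phi x0).

Let D j p (f : 'rV[R]_n -> R) := diffquot (basis R j) p.1 f p.2.
Let Z p := \sum_j D j p u ^+ 2.
Let Z1 i p := \sum_j 2 * D j p u * D j p (u1 i).
Let Z2 i p :=
  \sum_j (2 * D j p (u1 i) * D j p (u1 i) + 2 * D j p u * D j p (u2 i i)).

Let Du_cvg j : D j p u @[p --> approach x0] --> u1 j x0.
Proof.
apply: diffquot_cvg => //; first exact: norm_basis_le1.
by apply: filterS u_der => x; exact.
Qed.

Let Du1_cvg j i : D j p (u1 i) @[p --> approach x0] --> u2 j i x0.
Proof.
apply: diffquot_cvg => //; first exact: norm_basis_le1.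
by apply: filterS u1_der => x; exact.
Qed.

Let DF_cvg j : D j p F @[p --> approach x0] --> F1 j x0.
Proof.
apply: diffquot_cvg => //; first exact: norm_basis_le1.
by apply: filterS F_der => x; exact.
Qed.

Let near_shift_basis (P : 'rV[R]_n -> Prop) : (\forall x \near x0, P x) ->
  \forall p \near approach x0, P p.2 /\ forall j, P (p.1 *: basis R j + p.2).
Proof.
move=> HP.
have A : \forall p \near approach x0, forall j s, 0 <= s <= p.1 ->
    P (s *: basis R j + p.2).
  apply: filter_forall => j.
  by apply: near_approach_segment => //; exact: norm_basis_le1.
move: (near_approach_snd HP) A (near_approach_pos x0).
apply: (@filterS3 _ (approach x0)) => p Pp Hp p0; split => // j.
by apply: Hp; rewrite lexx ltW.
Qed.

Let Z_cvg : Z p @[p --> approach x0] --> z x0.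
Proof. by apply: cvg_sump => j; apply: cvgXp. Qed.

Let Z1_cvg i :
  Z1 i p @[p --> approach x0] --> \sum_j 2 * u1 j x0 * u2 j i x0.
Proof.
by apply: cvg_sump => j; apply: cvgM => //; apply: cvgM => //; exact: cvg_cst.
Qed.

Let Z2_cvg : \sum_i Z2 i p @[p --> approach x0] -->
  \sum_i \sum_j 2 * u2 j i x0 ^+ 2 + \sum_j 2 * u1 j x0 * F1 j x0.
Proof.
have E : \forall p \near approach x0,
    \sum_i \sum_j 2 * D j p (u1 i) ^+ 2 + \sum_j 2 * D j p u * D j p F =
    \sum_i Z2 i p.
  apply: filterS (near_shift_basis lap_u) => p [Fp Fj].
  rewrite [in RHS]/Z2; under [RHS]eq_bigr do rewrite big_split /=.
  rewrite big_split /=; congr (_ + _).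
    by apply: eq_bigr => i _; apply: eq_bigr => j _; rewrite expr2 mulrA.
  rewrite exchange_big /=; apply: eq_bigr => j _.
  rewrite -mulr_sumr; congr (_ * _).
  by rewrite /D /diffquot -Fp -Fj -sumrB mulr_suml.
apply: cvg_trans (near_eq_cvg E) _.
apply: cvgD.
  apply: cvg_sump => i; apply: cvg_sump => j.
  by apply: cvgM; [exact: cvg_cst|exact: cvgXp].
by apply: cvg_sump => j; apply: cvgM => //; apply: cvgM => //; exact: cvg_cst.
Qed.

Let Z_pos : \forall p \near approach x0, 0 < Z p.
Proof. exact: cvgr_gt Z_cvg _ z_gt0. Qed.

Let Z_rate : rate x0 (fun p => ln (Z p)) (fun p => ln (z p.2)).
Proof.
have zc : z p.2 @[p --> approach x0] --> z x0.
  by apply: cvg_sump => j; apply: cvgXp; exact: cvg_approach_snd.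
apply: rate_ln z_gt0 Z_cvg zc _; apply: rate_sum => j.
apply: (@rate_sqr _ _ _ (fun p => D j p u) (fun p => u1 j p.2) (u1 j x0)).
- exact: Du_cvg.
- by apply: cvg_approach_snd; exact: u1_cont.
apply: (diffquot_rate (ddf := u2 j j)) => //; first exact: norm_basis_le1.
  by apply: filterS u_der => x; exact.
by apply: filterS u1_der => x; exact.
Qed.

(** Bochner's formula at a maximum of [ln z + phi], for [u] of class C^2 only.
    The squared gradient [z] has no second derivatives, but the sum [Z] of
    the squares of the difference quotients of [u] has, and
    [(g ^ 2)'' = 2 g' ^ 2 + 2 g g''] gives for its Laplacian
    [2 * sum (D_j u_i) ^ 2 + 2 * sum D_j u * D_j (Laplacian u)]. This converges
    because the Laplacian of [u] is the C^1 function [F], so [penalised_max]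
    applies to [ln Z + phi]. *)
Lemma log_gradient_max :
  (forall i, (\sum_j 2 * u1 j x0 * u2 j i x0) / z x0 + phi1 i x0 = 0) /\
  (\sum_i \sum_j 2 * u2 j i x0 ^+ 2 + \sum_j 2 * u1 j x0 * F1 j x0) / z x0 -
    \sum_i ((\sum_j 2 * u1 j x0 * u2 j i x0) / z x0) ^+ 2 +
    \sum_i phi2 i x0 <= 0.
Proof.
have [M M0 LM] := Z_rate.
pose L e x := ln (Z (e, x)) + phi x.
pose G i p := Z1 i p / Z p + phi1 i p.2.
pose K i p := Z2 i p / Z p - (Z1 i p / Z p) ^+ 2 + phi2 i p.2.
have uD := near_shift_basis u_der.
have u1D := near_shift_basis u1_der.
have uC := near_shift_basis u_cont.
have DZ : \forall p \near approach x0, forall i,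
    is_derive p.2 (basis R i) (fun x => Z (p.1, x)) (Z1 i p).
  apply: filterS uD => p [D1 D2] i; apply: is_derive_sump => j.
  apply: (@is_deriveXp _ _ (fun x => D j (p.1, x) u)).
  by apply: is_derive_diffquot => //; exact: D2.
have DL : \forall p \near approach x0, forall i,
    is_derive p.2 (basis R i) (L p.1) (G i p).
  move: (near_approach_and Z_pos DZ) (near_approach_snd phi_der).
  apply: (@filterS2 _ (approach x0)) => p [Zp Dp] phip i.
  apply: is_deriveDp => //.
  by case: p Zp Dp phip => e x /= Zp Dp phip; exact: is_derive_lnp.
have DG : \forall p \near approach x0, forall i,
    is_derive p.2 (basis R i) (fun x => G i (p.1, x)) (K i p).
  have phip' := near_approach_snd phi1_der.
  move: (near_approach_and Z_pos DZ) (near_approach_and uD phip') u1D.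
  apply: (@filterS3 _ (approach x0)) => -[e x] [Zp Dp] [[D1 D2] phip] [E1 E2] i.
  apply: is_deriveDp => //.
  have -> : Z2 i (e, x) / Z (e, x) - (Z1 i (e, x) / Z (e, x)) ^+ 2 =
      Z2 i (e, x) / Z (e, x) - Z1 i (e, x) * Z1 i (e, x) / Z (e, x) ^+ 2.
    by rewrite exprMn exprVn -expr2.
  apply: (@is_derive_divp _ _ (fun x => Z1 i (e, x)) (fun x => Z (e, x))) => //.
    by rewrite gt_eqF.
  apply: is_derive_sump => j.
  apply: (@is_deriveMp _ _ (fun x => 2 * D j (e, x) u)
    (fun x => D j (e, x) (u1 i))).
    by apply: is_deriveZp; apply: is_derive_diffquot; exact: D2.
  by apply: (is_derive_diffquot (df := u2 i i)); [exact: E1|exact: E2].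
have CL : \forall p \near approach x0, {for p.2, continuous (L p.1)}.
  move: (near_approach_and uC Z_pos) (near_approach_snd phi_cont).
  apply: (@filterS2 _ (approach x0)) => -[e x] [[C1 C2] Zp] phix.
  apply: (@cvgD _ _ _ (nbhs x)); last exact: phix.
  apply: (@cvg_lnp _ _ (nbhs x)) => //.
  apply: (@cvg_sump _ _ (nbhs x)) => j; apply: (@cvgXp _ _ (nbhs x)).
  have sh : e *: basis R j + y @[y --> x] --> e *: basis R j + x.
    apply: (@cvgD _ _ _ (nbhs x)); last exact: cvg_id.
    exact: (@cvg_cst _ _ _ (nbhs x)).
  have ce : (fun _ : 'rV[R]_n => e^-1) y @[y --> x] --> e^-1.
    exact: (@cvg_cst _ _ _ (nbhs x)).
  apply: (@cvgM _ _ (nbhs x)) => /=; last exact: ce.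
  apply: (@cvgB _ _ _ (nbhs x)); last exact: C1.
  exact: (cvg_comp _ _ sh (C2 j)).
apply: (penalised_max (L := L) (G := G) (K := K) (M := M) z_max _ CL DL DG).
- apply: filterS LM => -[e x] /= H.
  rewrite (_ : _ - _ = ln (Z (e, x)) - ln (z x)) // /L.
  by rewrite opprD addrACA subrr addr0.
- move=> i; apply: cvgD; last exact: cvg_approach_snd.
  by apply: cvgM; [exact: Z1_cvg|apply: cvgV; rewrite ?gt_eqF].
- rewrite /K.
  have E : (fun p => \sum_i (Z2 i p / Z p - (Z1 i p / Z p) ^+ 2 + phi2 i p.2)) =
    (fun p => (\sum_i Z2 i p) / Z p - \sum_i (Z1 i p / Z p) ^+ 2 +
      \sum_i phi2 i p.2).
    apply/funext => p; rewrite big_split /= sumrB; congr (_ - _ + _).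
    by rewrite mulr_suml.
  rewrite E; apply: cvgD; last first.
    by apply: cvg_sump => i; exact: cvg_approach_snd.
  apply: cvgB.
    by apply: cvgM; [exact: Z2_cvg|apply: cvgV; rewrite ?gt_eqF].
  apply: cvg_sump => i; apply: cvgXp.
  by apply: cvgM; [exact: Z1_cvg|apply: cvgV; rewrite ?gt_eqF].
Qed.

End LogGradient.

(** * Algebra of the Bernstein inequality *)

Section Algebra.
Context (R : realType).

Lemma cauchy_schwarz_sum n (a b : 'I_n -> R) :
  (\sum_i a i * b i) ^+ 2 <= (\sum_i a i ^+ 2) * (\sum_i b i ^+ 2).
Proof.
set S := \sum_i a i * b i; set A := \sum_i a i ^+ 2; set B := \sum_i b i ^+ 2.
have A0 : 0 <= A by apply: sumr_ge0 => i _; exact: sqr_ge0.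
have quad t : 0 <= t ^+ 2 * A - 2 * t * S + B.
  have -> : t ^+ 2 * A - 2 * t * S + B = \sum_i (t * a i - b i) ^+ 2.
    rewrite /A /S /B !mulr_sumr -sumrB -big_split /=.
    by apply: eq_bigr => i _; ring.
  by apply: sumr_ge0 => i _; exact: sqr_ge0.
have [A00|A_neq0] := eqVneq A 0.
  have a0 i : a i = 0.
    have : a i ^+ 2 = 0.
      apply: (psumr_eq0P _ A00) => // j _; exact: sqr_ge0.
    by move/eqP; rewrite sqrf_eq0 => /eqP.
  rewrite A00 mul0r /S big1 ?expr0n // => i _.
  by rewrite a0 mul0r.
have Agt0 : 0 < A by rewrite lt_def A_neq0.
have := quad (S / A).
have -> : (S / A) ^+ 2 * A - 2 * (S / A) * S + B = B - S ^+ 2 / A.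
  by field.
by rewrite subr_ge0 ler_pdivrMr // mulrC.
Qed.

Lemma sum_diag n (f : 'I_n -> 'I_n -> R) :
  \sum_i \sum_j f i j * (j == i)%:R = \sum_i f i i.
Proof. by apply: eq_bigr => i _; rewrite sum_basis. Qed.

(** Bessel's inequality for the Frobenius product: [H] is projected on the
    orthogonal matrices [e e^T] and [1 - e e^T], of squared norms [1] and
    [m - 1], where [e] is the unit vector along [g]; [lam] is the entry of [H] in
    the direction [e]. Using the direction of the gradient is better than the
    bound [(tr H) ^ 2 / m], and is what brings [N - 1] into the exponents. *)
Lemma trace_bessel m (g : 'I_m -> R) (H : 'I_m -> 'I_m -> R) (z lam : R) :
  (1 < m)%N -> z = \sum_i g i ^+ 2 -> 0 < z ->
  \sum_i \sum_j g i * g j * H j i = z * lam ->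
  lam ^+ 2 + (\sum_i H i i - lam) ^+ 2 / (m%:R - 1) <=
    \sum_i \sum_j H j i ^+ 2.
Proof.
move=> m1 zE z0 lamE.
have n0 : 0 < m%:R - 1 :> R by rewrite subr_gt0 ltr1n.
set tr := \sum_i H i i; set n := m%:R - 1 in n0 *.
(* [H - a g g^T - t 1] is the component of [H] orthogonal to both matrices. *)
pose t := (tr - lam) / n; pose a := (lam - t) / z.
have : 0 <= \sum_i \sum_j (H j i - a * (g i * g j) - t * (j == i)%:R) ^+ 2.
  by apply: sumr_ge0 => i _; apply: sumr_ge0 => j _; exact: sqr_ge0.
have -> : \sum_i \sum_j (H j i - a * (g i * g j) - t * (j == i)%:R) ^+ 2 =
    \sum_i \sum_j H j i ^+ 2 + a ^+ 2 * z ^+ 2 + t ^+ 2 * m%:R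
    - 2 * a * (z * lam) - 2 * t * tr + 2 * a * t * z.
  have -> : z ^+ 2 = \sum_i \sum_j (g i * g j) ^+ 2.
    rewrite expr2 {1}zE mulr_suml; apply: eq_bigr => i _.
    by rewrite zE mulr_sumr; apply: eq_bigr => j _; rewrite exprMn.
  have -> : m%:R = \sum_i \sum_(j < m) (j == i)%:R :> R.
    under eq_bigr => i _ do
      (under eq_bigr => j _ do rewrite -[_%:R]mul1r); rewrite sum_diag.
    by rewrite sumr_const card_ord.
  rewrite -lamE /tr -(sum_diag (fun i j => H j i)) zE.
  rewrite -(sum_diag (fun i j => g i * g j)).
  rewrite !mulr_sumr -!big_split -!sumrB -!big_split /=; apply: eq_bigr => i _.
  rewrite !mulr_sumr -!big_split -!sumrB -!big_split /=; apply: eq_bigr => j _.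
  by case: eqP => _ /=; ring.
have mE : m%:R = n + 1 by rewrite /n subrK.
have trE : tr = n * t + lam.
  by rewrite /t mulrC divfK ?subrK // gt_eqF.
rewrite trE mE.
have -> : (n * t + lam - lam) ^+ 2 / n = n * t ^+ 2.
  by field; rewrite gt_eqF.
have -> : a ^+ 2 * z ^+ 2 = (lam - t) ^+ 2.
  by rewrite -exprMn /a divfK // gt_eqF.
have -> : 2 * a * (z * lam) = 2 * (lam - t) * lam.
  by rewrite /a; field; rewrite gt_eqF.
have -> : 2 * a * t * z = 2 * (lam - t) * t.
  by rewrite /a; field; rewrite gt_eqF.
by move=> H0; lra.
Qed.

(** A positive [B] only helps on the quadrant, so [B] may be replaced by
    [min B 0], for which the form is positive definite on the whole plane. *)
Lemma quadrant_form_coercive (A B C : R) : 0 < A -> 0 < C ->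
  - (2 * Num.sqrt (A * C)) < B ->
  exists2 c, 0 < c & forall x y, 0 <= x -> 0 <= y ->
    c * (x ^+ 2 + y ^+ 2) <= A * x ^+ 2 + B * x * y + C * y ^+ 2.
Proof.
move=> A0 C0 hB.
pose b := Num.min B 0.
have AC0 : 0 < A * C by rewrite mulr_gt0.
have s0 : 0 < Num.sqrt (A * C) by rewrite sqrtr_gt0.
have b0 : b <= 0 by rewrite ge_min lexx orbT.
have bB : b <= B by rewrite ge_min lexx.
have blt : - (2 * Num.sqrt (A * C)) < b.
  by rewrite lt_min hB oppr_lt0 mulr_gt0.
have b2 : b ^+ 2 < 4 * (A * C).
  rewrite -(sqr_sqrtr (ltW AC0)); set s := Num.sqrt _ in s0 blt *.
  have -> : 4 * s ^+ 2 = (2 * s) ^+ 2 by ring.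
  by rewrite -sqrrN ltr_pXn2r ?nnegrE //; lra.
have AC : 0 < A + C by rewrite addr_gt0.
pose c := (A * C - b ^+ 2 / 4) / (A + C).
have cE : c * (A + C) = A * C - b ^+ 2 / 4 by rewrite /c divfK // gt_eqF.
have c0 : 0 < c by rewrite divr_gt0 //; lra.
have Ac : 0 < A - c.
  rewrite -(pmulr_lgt0 _ AC) mulrBl cE.
  have : 0 < A ^+ 2 by rewrite exprn_gt0.
  have : 0 <= b ^+ 2 by exact: sqr_ge0.
  by rewrite expr2 => ? ?; lra.
exists c => // x y x0 y0.
have xy : b * x * y <= B * x * y.
  by rewrite -!mulrA; apply: ler_wpM2r => //; exact: mulr_ge0.
(* The choice of [c] turns the coefficient of [y ^ 2] below
   into [c ^ 2]. *)
suff : 0 <= (A - c) * (A * x ^+ 2 + b * x * y + C * y ^+ 2 - c * (x ^+ 2 + y ^+ 2)).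
  by rewrite pmulr_rge0 // subr_ge0 => /le_trans; apply; lra.
have -> : (A - c) * (A * x ^+ 2 + b * x * y + C * y ^+ 2 - c * (x ^+ 2 + y ^+ 2))
  = ((A - c) * x + b / 2 * y) ^+ 2 +
    (A * C - b ^+ 2 / 4 - c * (A + C) + c ^+ 2) * y ^+ 2 by field.
by rewrite cE subrr add0r addr_ge0 ?sqr_ge0 // mulr_ge0 ?sqr_ge0.
Qed.

(** Without the cutoff ([sg = 0]) the left-hand side is the quadratic form
    [A X^2 + B X f + f^2 / n] with [A = mu - mu^2 + mu^2 / n] and
    [B = mu * ((n + 2) / n - q) - p]. As [A = mu^2 s^2 / n], the last hypothesis
    says that [B > - 2 * sqrt (A / n)], so the form is coercive on the quadrant;
    Young's inequality absorbs the terms linear in [sg]. *)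
Lemma absorb_cutoff (n p q mu s : R) : 0 < n -> 0 < mu -> 0 < s ->
  mu - mu ^+ 2 + mu ^+ 2 / n = mu ^+ 2 * s ^+ 2 / n ->
  - (2 * mu * s) < mu * (n + 2 - n * q) - n * p ->
  exists2 C, 0 < C & forall X f sg W, 0 <= X -> 0 <= f -> sg ^+ 2 <= W ->
    let lam := mu * X + sg / 2 in
    lam ^+ 2 + (f + lam) ^+ 2 / n - f * (p * X + q * lam) + mu * X * f
      + mu * X ^+ 2 - 2 * mu ^+ 2 * X ^+ 2 - 2 * mu * sg * X <= W ->
    X ^+ 2 + f ^+ 2 <= C * W.
Proof.
move=> n0 mu0 s0 AE hB.
set A := mu ^+ 2 * s ^+ 2 / n in AE.
pose B := mu * ((n + 2) / n - q) - p.
have A0 : 0 < A by rewrite divr_gt0 // mulr_gt0 ?exprn_gt0.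
have n10 : 0 < n^-1 by rewrite invr_gt0.
have [|c c0 cP] := @quadrant_form_coercive A B n^-1 A0 n10.
  have -> : A * n^-1 = (mu * s / n) ^+ 2 by rewrite /A; field; rewrite gt_eqF.
  rewrite sqrtr_sqr gtr0_norm ?divr_gt0 ?mulr_gt0 //.
  rewrite -(ltr_pM2r n0) /B.
  have -> : - (2 * (mu * s / n)) * n = - (2 * mu * s) by field; rewrite gt_eqF.
  have -> // : (mu * ((n + 2) / n - q) - p) * n = mu * (n + 2 - n * q) - n * p.
  by field; rewrite gt_eqF.
pose a1 := mu / n - mu; pose a2 := n^-1 - q / 2.
pose D := 1 + (a1 ^+ 2 + a2 ^+ 2) / c.
have D0 : 0 < D.
  by rewrite ltr_wpDr // divr_ge0 ?addr_ge0 ?sqr_ge0 // ltW.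
exists (D / (3 * c / 4)); first by rewrite !divr_gt0 ?mulr_gt0.
move=> X f sg W X0 f0 sgW lam.
have -> : lam ^+ 2 + (f + lam) ^+ 2 / n - f * (p * X + q * lam) + mu * X * f
      + mu * X ^+ 2 - 2 * mu ^+ 2 * X ^+ 2 - 2 * mu * sg * X =
    (mu - mu ^+ 2 + mu ^+ 2 / n) * X ^+ 2 + B * X * f + n^-1 * f ^+ 2 +
    sg * (a1 * X + a2 * f) + (1 + n^-1) / 4 * sg ^+ 2.
  by rewrite /lam /B /a1 /a2; field; rewrite gt_eqF.
rewrite AE => H.
have young a y : - (c / 4 * y ^+ 2 + a ^+ 2 / c * sg ^+ 2) <= sg * (a * y).
  rewrite lerNl -subr_ge0 opprK.
  have -> : c / 4 * y ^+ 2 + a ^+ 2 / c * sg ^+ 2 + sg * (a * y) =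
    c * (y / 2 + a / c * sg) ^+ 2 by field; rewrite gt_eqF.
  by rewrite mulr_ge0 ?sqr_ge0 // ltW.
have H1 := young a1 X; have H2 := young a2 f; have H3 := cP X f X0 f0.
have s2 : 0 <= (1 + n^-1) / 4 * sg ^+ 2.
  by rewrite mulr_ge0 ?sqr_ge0 // divr_ge0 // addr_ge0 // ltW.
have DW : (a1 ^+ 2 + a2 ^+ 2) / c * sg ^+ 2 <= (a1 ^+ 2 + a2 ^+ 2) / c * W.
  by rewrite ler_wpM2l // divr_ge0 ?addr_ge0 ?sqr_ge0 // ltW.
rewrite mulrAC ler_pdivlMr ?divr_gt0 ?mulr_gt0 //.
have E : (a1 ^+ 2 + a2 ^+ 2) / c * sg ^+ 2 =
  a1 ^+ 2 / c * sg ^+ 2 + a2 ^+ 2 / c * sg ^+ 2 by ring.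
have E2 : D * W = W + (a1 ^+ 2 + a2 ^+ 2) / c * W by rewrite /D; ring.
have E3 : (X ^+ 2 + f ^+ 2) * (3 * c / 4) =
  c * (X ^+ 2 + f ^+ 2) - c / 4 * X ^+ 2 - c / 4 * f ^+ 2 by field.
have E4 : sg * (a1 * X + a2 * f) = sg * (a1 * X) + sg * (a2 * f).
  by rewrite mulrDr.
rewrite E2 E3; rewrite E in DW; rewrite E4 in H.
move: DW H H1 H2 H3 s2.
set t1 := a1 ^+ 2 / c * _; set t2 := a2 ^+ 2 / c * _; set t3 := _ / c * W.
set b1 := A * _; set b2 := B * X * f; set b3 := n^-1 * _.
set b4 := sg * (a1 * X); set b5 := sg * (a2 * f); set b6 := _ / 4 * sg ^+ 2.
set b7 := c / 4 * X ^+ 2; set b8 := c / 4 * f ^+ 2; set b9 := c * _.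
by move: t1 t2 t3 b1 b2 b3 b4 b5 b6 b7 b8 b9 => *; lra.
Qed.

End Algebra.

Section Exponents.
Context (R : realType).
Implicit Types (n p q a mu s : R).

(** The right-hand side equals [4] at [s = 1], whence the first case by taking
    [s] slightly larger. As a function of [s] it is maximal at [s = 1 / p], where
    it equals [(p + 1) ^ 2 / p], and [1 / p > 1] when [p < 1]. It is unbounded
    when [p = 0]. *)
Lemma exists_exponent n p q : 0 < n -> 0 <= p -> 0 < p + q - 1 ->
  (1 <= p /\ n * (p + q - 1) < 4) \/
  (p < 1 /\ (p = 0 \/ n * (p + q - 1) < (p + 1) ^+ 2 / p)) ->
  exists2 s, 1 < s & n * (p + q - 1) < 2 + 2 * s - p * (s ^+ 2 - 1).
Proof.
move=> n0 p0 Q0; set Q := p + q - 1 in Q0 *.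
have nQ0 : 0 < n * Q by rewrite mulr_gt0.
move=> [[p1 H]|[p1 [->|H]]].
- pose t := (4 - n * Q) / (4 * p + 4).
  have D0 : 0 < 4 * p + 4 by lra.
  have t0 : 0 < t by rewrite divr_gt0 // subr_gt0.
  have t1 : t < 1 by rewrite ltr_pdivrMr //; lra.
  have tE : t * (4 * p + 4) = 4 - n * Q by rewrite divfK // gt_eqF.
  exists (1 + t); first by rewrite ltrDl.
  have pt : p * t ^+ 2 <= p * t.
    by rewrite ler_wpM2l // expr2 ger_pMl // ltW.
  have pt0 : 0 < p * t by rewrite mulr_gt0 //; lra.
  have -> : 2 + 2 * (1 + t) - p * ((1 + t) ^+ 2 - 1) =
    4 + 2 * t - 2 * (p * t) - p * t ^+ 2 by ring.
  have E : t * (4 * p + 4) = 4 * (p * t) + 4 * t by ring.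
  by lra.
- by exists (1 + n * Q); [rewrite ltrDl|rewrite mul0r subr0; lra].
- have [p00|pn0] := eqVneq p 0.
    by move: H; rewrite p00 invr0 mulr0 => H; lra.
  have pp : 0 < p by rewrite lt_def pn0.
  exists p^-1; first by rewrite invf_gt1.
  have -> // : 2 + 2 * p^-1 - p * (p^-1 ^+ 2 - 1) = (p + 1) ^+ 2 / p by field.
Qed.

(** With this [mu], the coefficient of [X^2] in the form of [absorb_cutoff]
    becomes a perfect square over [n], and the condition on its discriminant
    becomes linear: it is [mu] times the inequality satisfied by [s]. *)
Lemma exponent_identities n p q s : 0 < n -> 1 < s ->
  let mu := n / (n + (s ^+ 2 - 1)) in
  n * (p + q - 1) < 2 + 2 * s - p * (s ^+ 2 - 1) ->
  [/\ 0 < mu, mu < 1, mu - mu ^+ 2 + mu ^+ 2 / n = mu ^+ 2 * s ^+ 2 / n &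
    - (2 * mu * s) < mu * (n + 2 - n * q) - n * p].
Proof.
move=> n0 s1 mu H.
have s2 : 0 < s ^+ 2 - 1 by rewrite subr_gt0 exprn_egt1.
have d0 : 0 < n + (s ^+ 2 - 1) by rewrite addr_gt0.
have mu0 : 0 < mu by rewrite divr_gt0.
split=> //.
- by rewrite ltr_pdivrMr // mul1r ltrDl.
- by rewrite /mu; field; rewrite !gt_eqF.
rewrite -subr_gt0.
have -> : mu * (n + 2 - n * q) - n * p - - (2 * mu * s) =
  mu * (2 + 2 * s - p * (s ^+ 2 - 1) - n * (p + q - 1)).
  by rewrite /mu; field; rewrite gt_eqF.
by rewrite mulr_gt0 // subr_gt0.
Qed.

(** In exponential form, [z * P `^ (1 / d)] is at most the larger of [X^2] and
    [f^2], where [X = z / u], [f = u `^ p * z `^ (q / 2)],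
    [P = z * u `^ (- 2 * (1 - a))], [y = ln z] and [l = ln u]: the left-hand side
    is a geometric mean of [X^2] and [f^2], and scaling forces the value
    of [d]. *)
Lemma log_interpolation p q a d l y S : 0 <= p -> 0 < p + q - 1 -> q < 2 ->
  0 < a < 1 -> d = 1 + a * ((2 - q) / (p + q - 1)) ->
  2 * (y - l) <= S -> 2 * (p * l + q / 2 * y) <= S ->
  d * y + (y - 2 * (1 - a) * l) <= d * S.
Proof.
move=> p0 Q0 q2 /andP[a0 a1] dE h1 h2.
have w0 : 0 < 2 - q by rewrite subr_gt0.
have d1 : 1 < d by rewrite dE ltrDl mulr_gt0 // divr_gt0.
have d0 : 0 < d by lra.
have p10 : 0 < 1 + p by lra.
(* [tau / d] is the weight of [X^2] in the geometric mean. *)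
pose tau := (d * p + (1 - a)) / (1 + p).
have dp0 : 0 <= d * p by rewrite mulr_ge0 // ltW.
have tau0 : 0 <= tau by apply: divr_ge0; lra.
have taud : 0 <= d - tau.
  by rewrite subr_ge0 ler_pdivrMr // mulrDr mulr1; lra.
have e1 := ler_wpM2l tau0 h1; have e2 := ler_wpM2l taud h2.
have -> : d * y + (y - 2 * (1 - a) * l) =
  tau * (2 * (y - l)) + (d - tau) * (2 * (p * l + q / 2 * y)).
  by rewrite /tau dE; field; rewrite !gt_eqF.
have -> : d * S = tau * S + (d - tau) * S by ring.
exact: lerD.
Qed.

(** The first order condition determines the entry [lam] of the Hessian along
    the gradient [g]: it is [mu * X], up to the contribution [sg / 2] of the
    cutoff whose logarithm has derivatives [psi1] and [psi2]. Inserting this and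
    [trace_bessel] into the second order condition leaves an inequality between
    the two scalars [X] and [f]. *)
Lemma bernstein_pointwise m (g psi1 psi2 F1 : 'I_m -> R)
    (H : 'I_m -> 'I_m -> R) (u f z p q mu : R) :
  (1 < m)%N -> 0 < u -> z = \sum_i g i ^+ 2 -> 0 < z ->
  \sum_i H i i = - f ->
  (forall j, F1 j =
    - (f * (p * (g j / u) + q / 2 * ((\sum_k 2 * g k * H j k) / z)))) ->
  (forall i, (\sum_j 2 * g j * H j i) / z + (psi1 i - 2 * mu * (g i / u)) = 0) ->
  (\sum_i \sum_j 2 * H j i ^+ 2 + \sum_j 2 * g j * F1 j) / z
    - \sum_i ((\sum_j 2 * g j * H j i) / z) ^+ 2
    + \sum_i (psi2 i - 2 * mu * (H i i / u - g i * g i / u ^+ 2)) <= 0 ->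
  forall X sg lam : R, X = z / u -> sg = - \sum_i psi1 i * g i ->
  lam = mu * X + sg / 2 ->
  lam ^+ 2 + (f + lam) ^+ 2 / (m%:R - 1) - f * (p * X + q * lam) + mu * X * f
      + mu * X ^+ 2 - 2 * mu ^+ 2 * X ^+ 2 - 2 * mu * sg * X
    <= z / 2 * (\sum_i psi1 i ^+ 2 - \sum_i psi2 i).
Proof.
move=> m1 u0 zE z0 trE F1E hG hL X sg lam XE sgE lamE.
have un0 : u != 0 by rewrite gt_eqF.
have zn0 : z != 0 by rewrite gt_eqF.
pose gH i := \sum_j 2 * g j * H j i.
have gHE i : gH i / z = 2 * mu * (g i / u) - psi1 i.
  by apply/eqP; rewrite -subr_eq0 opprB addrC addrAC -(hG i) /gH; apply/eqP; ring.
have Hgg : \sum_i \sum_j g i * g j * H j i = z * lam.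
  have -> : \sum_i \sum_j g i * g j * H j i = z / 2 * \sum_i g i * (gH i / z).
    rewrite mulr_sumr; apply: eq_bigr => i _.
    rewrite /gH mulr_suml !mulr_sumr; apply: eq_bigr => j _.
    by field.
  suff -> : \sum_i g i * (gH i / z) = 2 * lam by field.
  under eq_bigr => i _ do rewrite gHE mulrBr.
  rewrite sumrB lamE sgE XE zE.
  have -> : \sum_i g i * (2 * mu * (g i / u)) = 2 * mu * (\sum_i g i ^+ 2) / u.
    by rewrite mulr_sumr mulr_suml; apply: eq_bigr => i _; field.
  have -> : \sum_i g i * psi1 i = \sum_i psi1 i * g i.
    by apply: eq_bigr => i _; rewrite mulrC.
  by field.
have hB := trace_bessel m1 zE z0 Hgg.
have gF : \sum_j 2 * g j * F1 j = - (2 * f * (p * X + q * lam)).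
  have -> : \sum_j 2 * g j * F1 j = - (2 * f * (p * ((\sum_j g j ^+ 2) / u)
      + q * ((\sum_j \sum_k g j * g k * H j k) / z))).
    rewrite !mulr_suml !mulr_sumr -big_split mulr_sumr -sumrN /=.
    apply: eq_bigr => j _; rewrite F1E.
    have -> : \sum_k 2 * g k * H j k = 2 * \sum_k g k * H j k.
      by rewrite mulr_sumr; apply: eq_bigr => k _; rewrite mulrA.
    have -> : \sum_k g j * g k * H j k = g j * \sum_k g k * H j k.
      by rewrite mulr_sumr; apply: eq_bigr => k _; rewrite mulrA.
    set T := \sum_k g k * H j k.
    by field; rewrite ?un0 ?zn0.
  rewrite -zE exchange_big /=.
  under eq_bigr => i _ do under eq_bigr => j _ do rewrite [g j * g i]mulrC.
  by rewrite Hgg XE; field; rewrite un0.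
have sq : \sum_i (gH i / z) ^+ 2 =
    4 * mu ^+ 2 * (X / u) + 4 * mu * sg / u + \sum_i psi1 i ^+ 2.
  under eq_bigr => i _ do rewrite gHE.
  rewrite XE sgE zE mulrN mulNr.
  rewrite !(mulr_suml, mulr_sumr) -sumrN -!big_split /=.
  by apply: eq_bigr => i _; field.
have ps : \sum_i (psi2 i - 2 * mu * (H i i / u - g i * g i / u ^+ 2)) =
    \sum_i psi2 i + 2 * mu * (f / u) + 2 * mu * (X / u).
  have -> : f = - \sum_i H i i by rewrite trE opprK.
  rewrite XE zE mulNr mulrN !(mulr_suml, mulr_sumr) -sumrN -!big_split /=.
  by apply: eq_bigr => i _; field.
have HH : \sum_i \sum_j 2 * H j i ^+ 2 = 2 * \sum_i \sum_j H j i ^+ 2.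
  rewrite mulr_sumr; apply: eq_bigr => i _; by rewrite mulr_sumr.
rewrite HH gF -/(gH _) sq ps in hL.
set S := \sum_i \sum_j _ in hB hL; set E := \sum_i psi1 i ^+ 2 in hL *.
set P2 := \sum_i psi2 i in hL *.
have hL' : S - f * (p * X + q * lam) - 2 * mu ^+ 2 * X ^+ 2 - 2 * mu * sg * X
   - z / 2 * E + z / 2 * P2 + mu * X * f + mu * X ^+ 2 <= 0.
  rewrite -(pmulr_lle0 _ z0) in hL.
  set lhs := (X in X <= 0) in hL.
  suff -> : S - f * (p * X + q * lam) - 2 * mu ^+ 2 * X ^+ 2 - 2 * mu * sg * X
   - z / 2 * E + z / 2 * P2 + mu * X * f + mu * X ^+ 2 = lhs / 2 by lra.
  by rewrite /lhs XE; field; rewrite un0.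
rewrite trE in hB.
have hf : (- f - lam) ^+ 2 = (f + lam) ^+ 2 by ring.
rewrite hf in hB.
move: hB hL'; rewrite !mulrBr.
set t1 := _ / (m%:R - 1); set t2 := f * _; set t3 := 2 * mu ^+ 2 * _.
by set t4 := 2 * mu * sg * _; lra.
Qed.

End Exponents.

Section Bookkeeping.
Context (R : realType).

(** Comparison of the values of the weighted function at the centre, where the
    cutoff is [rho ^ 2], and at the maximum. The power [k] of the cutoff is larger
    than the critical power [2 * d]; the excess is harmless because the cutoff is
    largest at the centre. *)
Lemma centre_bound (d k S y w e v c g : R) : 0 < d -> 2 * d <= k ->
  d * y + w <= d * S -> S <= c + y + 2 * v - 2 * e -> e <= 2 * v ->
  k * (2 * v) + g <= k * e + w -> g <= d * (c - 2 * v).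
Proof.
move=> d0 dk h3 h4 h5 gmax.
have h4d := ler_wpM2l (ltW d0) h4.
have h5k : (k - 2 * d) * e <= (k - 2 * d) * (2 * v).
  by apply: ler_wpM2l => //; rewrite subr_ge0.
by lra.
Qed.

End Bookkeeping.

(** * Positive solutions at an interior maximum *)

Section Solutions.
Context (R : realType) (N : nat).
Implicit Types (x : 'rV[R]_N) (u : 'rV[R]_N -> R) (r rho p q mu : R).

Definition sqnorm x : R := \sum_i x ord0 i ^+ 2.

Definition grad2 u x : R := \sum_i partial i u x ^+ 2.

Lemma continuous_sqnorm : continuous sqnorm.
Proof.
move=> x; apply: (@cvg_sump _ _ (nbhs x)) => i; apply: (@cvgXp _ _ (nbhs x)).
exact: continuous_coord.
Qed.

Lemma is_derive_sqnorm x i : is_derive x (basis R i) sqnorm (2 * x ord0 i).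
Proof.
rewrite -(sum_basis (fun j => 2 * x ord0 j) i).
apply: is_derive_sump => j.
apply: (@is_deriveXp _ _ (fun y : 'rV[R]_N => y ord0 j) _ _ _ 1).
by rewrite -basisE; exact: is_derive_coord.
Qed.

Lemma sqnorm_ge0 x : 0 <= sqnorm x.
Proof. by apply: sumr_ge0 => i _; exact: sqr_ge0. Qed.

Lemma eballE r x : 0 < r -> eball r x <-> sqnorm x < r ^+ 2.
Proof.
move=> r0; rewrite /eball /= /enorm -/(sqnorm x).
split=> H.
  rewrite -(sqr_sqrtr (sqnorm_ge0 x)) ltr_pXn2r ?nnegrE ?sqrtr_ge0 //.
  exact: ltW.
by rewrite -(gtr0_norm r0) -sqrtr_sqr ltr_sqrt // exprn_gt0.
Qed.

Lemma Ck2_regular u (A : set 'rV[R]_N) : Ck_on 2 A u -> forall x, A x ->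
  [/\ {for x, continuous u},
     forall i, is_derive x (basis R i) u (partial i u x),
     forall i, {for x, continuous (partial i u)},
     forall i j,
       is_derive x (basis R j) (partial i u) (partial j (partial i u) x)
   & forall i j, {for x, continuous (partial j (partial i u))}].
Proof.
move=> [uc H] x Ax; split => [|i|i|i j|i j]; first exact: uc.
- by have [D _] := H i; apply: derivableP; exact: D.
- by have [_ [C _]] := H i; exact: C.
- by have [_ [_ /(_ j)[D _]]] := H i; apply: derivableP; exact: D.
- by have [_ [_ /(_ j)[_ [C _]]]] := H i; exact: C.
Qed.

Lemma near_eball r x : 0 < r -> eball r x -> \forall y \near x, eball r y.
Proof.
move=> r0 /(eballE _ r0) xr.
have : \forall y \near x, sqnorm y < r ^+ 2.
  exact: (cvgr_lt (sqnorm x) (@continuous_sqnorm x) _ xr).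
by apply: filterS => y /(eballE _ r0).
Qed.

(** Where the gradient does not vanish, the right-hand side of the equation is a
    smooth function of [u] and of its gradient; the logarithmic form makes its
    derivatives easy to compute. *)
Lemma laplacian_log p q (A : set 'rV[R]_N) u x :
  positive_solution p q A u -> A x -> 0 < grad2 u x ->
  \sum_i partial i (partial i u) x =
    - expR (p * ln (u x) + q / 2 * ln (grad2 u x)).
Proof.
move=> [_ upos ueq] Ax z0; have ux := upos x Ax.
have := ueq x Ax; rewrite /laplacian => /(congr1 (fun t => - t)).
rewrite opprK => ->; congr (- _).
have -> : enorm (gradient u x) = grad2 u x `^ 2^-1.
  rewrite powR12_sqrt ?ltW // /enorm; congr (Num.sqrt _).
  by apply: eq_bigr => i _; rewrite mxE.
by rewrite -powRrM /powR !gt_eqF // -expRD [2^-1 * q]mulrC.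
Qed.

Lemma is_derive_grad2 u x i :
  (forall k, is_derive x (basis R i) (partial k u) (partial i (partial k u) x)) ->
  is_derive x (basis R i) (grad2 u)
    (\sum_k 2 * partial k u x * partial i (partial k u) x).
Proof.
move=> D; apply: is_derive_sump => k.
exact: (@is_deriveXp _ _ (partial k u) _ _ _ 1).
Qed.

End Solutions.

Section InteriorMaximum.
Context (R : realType) (N k : nat) (p q mu r rho : R)
  (u : 'rV[R]_N -> R) (x0 : 'rV[R]_N).

Let eta (x : 'rV[R]_N) := rho ^+ 2 - sqnorm x.
Let z := grad2 u.
Let f x := expR (p * ln (u x) + q / 2 * ln (z x)).
Let u2 j i := partial j (partial i u).
Let u1 i := partial i u.

Context (N1 : (1 < N)%N) (r0 : 0 < r)
  (sol : positive_solution p q (eball r) u)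
  (x0r : eball r x0) (eta0 : 0 < eta x0) (z0 : 0 < z x0).

Let eta1 i (x : 'rV[R]_N) := - (2 * x ord0 i).
Let phi x := k%:R * ln (eta x) - 2 * mu * ln (u x).
Let psi1 i x := k%:R * (eta1 i x / eta x).
Let psi2 i x := k%:R * (- 2 / eta x - eta1 i x * eta1 i x / eta x ^+ 2).
Let phi1 i x := psi1 i x - 2 * mu * (u1 i x / u x).
Let phi2 i x :=
  psi2 i x - 2 * mu * (u2 i i x / u x - u1 i x * u1 i x / u x ^+ 2).
Let F1 j x :=
  - (f x * (p * (u1 j x / u x) + q / 2 * ((\sum_k 2 * u1 k x * u2 j k x) / z x))).

Let reg : Ck_on 2 (eball r) u.
Proof. by have [] := sol. Qed.

Let upos x : eball r x -> 0 < u x.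
Proof. by have [_ H _] := sol; exact: H. Qed.

Let eta_cont : continuous eta.
Proof.
move=> x; apply: (@cvgB _ _ _ (nbhs x)); last exact: continuous_sqnorm.
exact: (@cvg_cst _ _ _ (nbhs x)).
Qed.

Let u1_cont x i : eball r x -> {for x, continuous (u1 i)}.
Proof. by move=> xr; have [_ _ C _ _] := Ck2_regular reg xr; exact: C. Qed.

Let u2_cont x j i : eball r x -> {for x, continuous (u2 j i)}.
Proof. by move=> xr; have [_ _ _ _ C] := Ck2_regular reg xr; exact: C. Qed.

Let u_cont x : eball r x -> {for x, continuous u}.
Proof. by move=> xr; have [C _ _ _ _] := Ck2_regular reg xr. Qed.

Let z_cont x : eball r x -> {for x, continuous z}.
Proof.
move=> xr; apply: (@cvg_sump _ _ (nbhs x)) => i; apply: (@cvgXp _ _ (nbhs x)).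
exact: u1_cont.
Qed.

Let good : \forall x \near x0, [/\ eball r x, 0 < eta x & 0 < z x].
Proof.
have A : \forall x \near x0, 0 < eta x.
  exact: (cvgr_gt (eta x0) (@eta_cont x0) _ eta0).
have B : \forall x \near x0, 0 < z x.
  exact: (cvgr_gt (z x0) (z_cont x0r) _ z0).
have C := near_eball r0 x0r.
by near do split.
Unshelve. all: by end_near. Qed.

Let eta_der x i : is_derive x (basis R i) eta (eta1 i x).
Proof.
rewrite /eta1 -[- _]add0r; apply: is_deriveBp; exact: is_derive_sqnorm.
Qed.

Let phi_der x i : eball r x -> 0 < eta x ->
  is_derive x (basis R i) phi (phi1 i x).
Proof.
move=> xr ex; apply: is_deriveBp; apply: is_deriveZp; apply: is_derive_lnp => //.
  exact: upos.
by have [_ D _ _ _] := Ck2_regular reg xr; exact: D.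
Qed.

Let eta1_der x i : is_derive x (basis R i) (eta1 i) (- 2).
Proof.
rewrite /eta1 (_ : (fun x => _) = (fun x : 'rV[R]_N => - 2 * x ord0 i)).
  rewrite -[X in is_derive _ _ _ X]mulr1; apply: is_deriveZp.
  by have := is_derive_coord x (basis R i) i; rewrite basisE eqxx.
by apply/funext => y; rewrite mulNr.
Qed.

Let phi1_der x i : eball r x -> 0 < eta x ->
  is_derive x (basis R i) (phi1 i) (phi2 i x).
Proof.
move=> xr ex; have [_ D1 _ D2 _] := Ck2_regular reg xr.
have en0 : eta x != 0 by rewrite gt_eqF.
have un0 : u x != 0 by rewrite gt_eqF // upos.
apply: is_deriveBp; apply: is_deriveZp.
  exact: (is_derive_divp en0 (eta1_der x i) (eta_der x i)).
exact: (is_derive_divp un0 (D2 i i) (D1 i)).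
Qed.

Let f_der x i : eball r x -> 0 < z x ->
  is_derive x (basis R i) (fun y => - f y) (F1 i x).
Proof.
move=> xr zx; have [_ D1 _ D2 _] := Ck2_regular reg xr.
apply: is_deriveN; apply: is_derive_expRp.
apply: is_deriveDp; apply: is_deriveZp; apply: is_derive_lnp => //.
  exact: upos.
by apply: is_derive_grad2 => j; exact: D2.
Qed.

Let cvg_div (a b : 'rV[R]_N -> R) : {for x0, continuous a} ->
  {for x0, continuous b} -> 0 < b x0 ->
  {for x0, continuous (fun x => a x / b x)}.
Proof.
move=> ac bc b0; apply: (@cvgM _ _ (nbhs x0)) => //.
by apply: (@cvgV _ _ (nbhs x0)) => //; rewrite gt_eqF.
Qed.

Let cvg_scale c (a : 'rV[R]_N -> R) : {for x0, continuous a} ->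
  {for x0, continuous (fun x => c * a x)}.
Proof.
move=> ac; apply: (@cvgM _ _ (nbhs x0)) => //.
exact: (@cvg_cst _ _ _ (nbhs x0)).
Qed.

Let ux0 : 0 < u x0. Proof. exact: upos. Qed.

Let eta1_cont i : {for x0, continuous (eta1 i)}.
Proof.
apply: (@cvgN _ _ _ (nbhs x0)); apply: cvg_scale; exact: continuous_coord.
Qed.

Let phi1_cont i : {for x0, continuous (phi1 i)}.
Proof.
apply: (@cvgB _ _ _ (nbhs x0)); apply: cvg_scale; apply: cvg_div => //.
- exact: eta_cont.
- exact: u1_cont.
- exact: u_cont.
Qed.

Let cst_cont (c : R) : {for x0, continuous (fun _ : 'rV[R]_N => c)}.
Proof. exact: (@cvg_cst _ _ _ (nbhs x0)). Qed.

Let phi2_cont i : {for x0, continuous (phi2 i)}.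
Proof.
have ec : {for x0, continuous eta} by exact: eta_cont.
have uc : {for x0, continuous u} by exact: u_cont.
have u1c : {for x0, continuous (u1 i)} by exact: u1_cont.
apply: (@cvgB _ _ _ (nbhs x0)); apply: cvg_scale;
  apply: (@cvgB _ _ _ (nbhs x0)); apply: cvg_div => //.
- by apply: (@cvgM _ _ (nbhs x0)); exact: eta1_cont.
- by apply: (@cvgXp _ _ (nbhs x0)).
- by rewrite exprn_gt0.
- exact: u2_cont.
- by apply: (@cvgM _ _ (nbhs x0)).
- by apply: (@cvgXp _ _ (nbhs x0)).
- by rewrite exprn_gt0.
Qed.

Let F1_cont i : {for x0, continuous (F1 i)}.
Proof.
have uc : {for x0, continuous u} by exact: u_cont.
have zc : {for x0, continuous z} by exact: z_cont.
apply: (@cvgN _ _ _ (nbhs x0)); apply: (@cvgM _ _ (nbhs x0)).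
  apply: (@cvg_expRp _ _ (nbhs x0)); apply: (@cvgD _ _ _ (nbhs x0));
    by apply: cvg_scale; apply: (@cvg_lnp _ _ (nbhs x0)).
apply: (@cvgD _ _ _ (nbhs x0)); apply: cvg_scale; apply: cvg_div => //.
  exact: u1_cont.
apply: (@cvg_sump _ _ (nbhs x0)) => j; apply: (@cvgM _ _ (nbhs x0)).
  by apply: cvg_scale; exact: u1_cont.
exact: u2_cont.
Qed.

Let phi_cont x : eball r x -> 0 < eta x -> {for x, continuous phi}.
Proof.
move=> xr ex; apply: (@cvgB _ _ _ (nbhs x)); apply: (@cvgM _ _ (nbhs x));
  try exact: (@cvg_cst _ _ _ (nbhs x)).
- by apply: (@cvg_lnp _ _ (nbhs x)) => //; exact: eta_cont.
- by apply: (@cvg_lnp _ _ (nbhs x)); [exact: upos|exact: u_cont].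
Qed.

(** The logarithm of the cutoff [eta ^+ k] has gradient and Laplacian of size
    [rho / eta] and [(rho / eta) ^ 2], so the error terms of
    [bernstein_pointwise] are at most a multiple of [z * (rho / eta) ^ 2], which
    [absorb_cutoff] compares with [X ^ 2 + f ^ 2]. *)
Lemma interior_max_bound (C : R) :
  (forall X f sg W, 0 <= X -> 0 <= f -> sg ^+ 2 <= W ->
    let lam := mu * X + sg / 2 in
    lam ^+ 2 + (f + lam) ^+ 2 / (N%:R - 1) - f * (p * X + q * lam) + mu * X * f
      + mu * X ^+ 2 - 2 * mu ^+ 2 * X ^+ 2 - 2 * mu * sg * X <= W ->
    X ^+ 2 + f ^+ 2 <= C * W) ->
  (\forall x \near x0, ln (z x) + (k%:R * ln (eta x) - 2 * mu * ln (u x))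
    <= ln (z x0) + (k%:R * ln (eta x0) - 2 * mu * ln (u x0))) ->
  (z x0 / u x0) ^+ 2 + f x0 ^+ 2 <=
    C * (z x0 * ((4 * k%:R ^+ 2 + k%:R * (2 * N%:R + 4)) *
      (rho ^+ 2 / eta x0 ^+ 2))).
Proof.
move=> HC zmax.
have h1 : \forall x \near x0, {for x, continuous u}.
  by apply: filterS good => x [xr _ _]; exact: u_cont.
have h2 : \forall x \near x0, forall i, is_derive x (basis R i) u (u1 i x).
  apply: filterS good => x [xr _ _] i.
  by have [_ D _ _ _] := Ck2_regular reg xr; exact: D.
have h3 i : {for x0, continuous (u1 i)} by exact: u1_cont.
have h4 : \forall x \near x0, forall j i,
    is_derive x (basis R j) (u1 i) (u2 j i x).
  apply: filterS good => x [xr _ _] j i.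
  by have [_ _ _ D _] := Ck2_regular reg xr; exact: D.
have h5 j i : {for x0, continuous (u2 j i)} by exact: u2_cont.
have h6 : \forall x \near x0, \sum_i u2 i i x = - f x.
  by apply: filterS good => x [xr _ zx]; exact: (laplacian_log sol xr zx).
have h7 : \forall x \near x0, forall i,
    is_derive x (basis R i) (fun y => - f y) (F1 i x).
  by apply: filterS good => x [xr _ zx] i; exact: f_der.
have h8 : \forall x \near x0, {for x, continuous phi}.
  by apply: filterS good => x [xr ex _]; exact: phi_cont.
have h9 : \forall x \near x0, forall i, is_derive x (basis R i) phi (phi1 i x).
  by apply: filterS good => x [xr ex _] i; exact: phi_der.
have h10 : \forall x \near x0, forall i,
    is_derive x (basis R i) (phi1 i) (phi2 i x).
  by apply: filterS good => x [xr ex _] i; exact: phi1_der.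
have [hG hL] := log_gradient_max h1 h2 h3 h4 h5 h6 h7 F1_cont h8 h9 h10
  phi1_cont phi2_cont z0 zmax.
pose sg := - \sum_i psi1 i x0 * u1 i x0.
pose E := \sum_i psi1 i x0 ^+ 2.
have key := bernstein_pointwise N1 ux0 (erefl (z x0)) z0
  (nbhs_singleton h6) (fun j => erefl (F1 j x0)) hG hL
  (erefl (z x0 / u x0)) (erefl sg) (erefl (mu * (z x0 / u x0) + sg / 2)).
have e2 : 0 < eta x0 ^+ 2 by rewrite exprn_gt0.
have en0 : eta x0 != 0 by rewrite gt_eqF.
set T := rho ^+ 2 / eta x0 ^+ 2.
have etale : eta x0 <= rho ^+ 2 by rewrite gerBl sqnorm_ge0.
have sqle : sqnorm x0 <= rho ^+ 2 by rewrite -subr_ge0 ltW.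
have sqT : sqnorm x0 / eta x0 ^+ 2 <= T.
  by rewrite ler_wpM2r // invr_ge0 ltW.
have etaT : (eta x0)^-1 <= T.
  by rewrite /T ler_pdivlMr // expr2 mulrA mulVf // mul1r.
have T0 : 0 <= T by rewrite (le_trans _ etaT) // invr_ge0 ltW.
have EE : E = 4 * k%:R ^+ 2 * (sqnorm x0 / eta x0 ^+ 2).
  rewrite /E /sqnorm mulr_suml mulr_sumr; apply: eq_bigr => i _.
  by rewrite /psi1 /eta1; field.
have P2 : \sum_i psi2 i x0 =
    - (k%:R * (2 * N%:R * (eta x0)^-1 + 4 * (sqnorm x0 / eta x0 ^+ 2))).
  have -> : (N%:R : R) = \sum_(i < N) 1 by rewrite sumr_const card_ord.
  rewrite /sqnorm !(mulr_suml, mulr_sumr) -big_split mulr_sumr -sumrN /=.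
  by apply: eq_bigr => i _; rewrite /psi2 /eta1; field.
have k0 : 0 <= k%:R :> R by [].
have kN : 0 <= k%:R * N%:R :> R by rewrite mulr_ge0.
have ET : E <= 4 * k%:R ^+ 2 * T.
  by rewrite EE ler_wpM2l // mulr_ge0 ?sqr_ge0.
have PT : - \sum_i psi2 i x0 <= k%:R * (2 * N%:R + 4) * T.
  rewrite P2 opprK -[leRHS]mulrA; apply: ler_wpM2l => //.
  by rewrite [leRHS]mulrDl; apply: lerD; apply: ler_wpM2l.
have PT0 : 0 <= k%:R * (2 * N%:R + 4) * T.
  by apply: mulr_ge0 => //; apply: mulr_ge0 => //; apply: addr_ge0.
have E0 : 0 <= E by apply: sumr_ge0 => i _; exact: sqr_ge0.
rewrite mulrDl.
apply: (HC _ _ sg).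
- by rewrite divr_ge0 // ltW.
- exact: expR_ge0.
- rewrite sqrrN; apply: le_trans (cauchy_schwarz_sum _ _) _.
  rewrite -/E [X in E * X](_ : _ = z x0) // [E * _]mulrC.
  by apply: ler_wpM2l; [exact: ltW|lra].
apply: le_trans key _.
rewrite -/E -mulrA; apply: ler_wpM2l; first exact: ltW.
by lra.
Qed.

End InteriorMaximum.

(** * Existence of the maximum and conclusion *)

Section WeightedMaximum.
Context (R : realType) (N k : nat) (p q mu r rho : R) (u : 'rV[R]_N -> R).

Let eta (x : 'rV[R]_N) := rho ^+ 2 - sqnorm x.
Let z := grad2 u.
Let J x := eta x ^+ k * (z x * expR (- (2 * mu) * ln (u x))).

Lemma sqnorm0 : sqnorm (0 : 'rV[R]_N) = 0.
Proof. by rewrite /sqnorm big1 // => i _; rewrite mxE expr0n. Qed.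

Let lnJ x : 0 < eta x -> 0 < z x ->
  ln (J x) = k%:R * ln (eta x) + (ln (z x) - 2 * mu * ln (u x)).
Proof.
move=> ex zx.
have E0 : 0 < expR (- (2 * mu) * ln (u x)) by exact: expR_gt0.
rewrite /J lnM ?posrE ?exprn_gt0 ?mulr_gt0 // lnXn // lnM ?posrE //.
by rewrite expRK mulNr [k%:R * _]mulr_natl.
Qed.

Let J_gt0 x : 0 < eta x -> 0 < z x -> 0 < J x.
Proof.
by move=> ex zx; rewrite /J mulr_gt0 ?exprn_gt0 // mulr_gt0 // expR_gt0.
Qed.

(** The weighted function [J] vanishes where [eta] or [z] does and is positive
    at the centre, so its maximum over the closed ball lies in the region where
    logarithms may be taken. An integer power of [eta] keeps [J] continuous up to
    the boundary. *)
Lemma weighted_max_exists : (0 < k)%N -> 0 < rho < r ->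
  positive_solution p q (eball r) u -> 0 < z 0 ->
  exists x0, [/\ 0 < eta x0, 0 < z x0, eball r x0,
    \forall x \near x0, ln (z x) + (k%:R * ln (eta x) - 2 * mu * ln (u x))
      <= ln (z x0) + (k%:R * ln (eta x0) - 2 * mu * ln (u x0)) &
    k%:R * ln (rho ^+ 2) + (ln (z 0) - 2 * mu * ln (u 0)) <=
      k%:R * ln (eta x0) + (ln (z x0) - 2 * mu * ln (u x0))].
Proof.
move=> k0 /andP[rho0 rhor] [reg upos _] z00.
have r0 : 0 < r by exact: lt_trans rhor.
pose B := [set x : 'rV[R]_N | sqnorm x <= rho ^+ 2].
have Br x : B x -> eball r x.
  move=> xB; apply/eballE => //; apply: le_lt_trans xB _.
  by rewrite ltr_pXn2r // nnegrE ltW.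
have B0 : B 0 by rewrite /B /= sqnorm0 sqr_ge0.
have Bc : compact B.
  apply: (@subclosed_compact _ _ [set x | `|x - 0| <= rho]).
  - rewrite (_ : B = @sqnorm R N @^-1` [set t | t <= rho ^+ 2]) //.
    apply: closed_comp; last exact: closed_le.
    by move=> x _; exact: continuous_sqnorm.
  - exact: compact_box (ltW rho0).
  - move=> x xB /=; rewrite subr0; apply: norm_le_coord; first exact: ltW.
    move=> i; rewrite -(@ler_pXn2r _ 2) ?nnegrE ?normr_ge0 //; last exact: ltW.
    rewrite real_normK ?num_real //; apply: le_trans xB.
    rewrite /sqnorm (bigD1 i) //= lerDl.
    by apply: sumr_ge0 => j _; exact: sqr_ge0.
have Jc : {within B, continuous J}.
  apply: continuous_in_subspaceT => x; rewrite inE => /Br xr.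
  have [uc _ u1c _ _] := Ck2_regular reg xr.
  apply: (@cvgM _ _ (nbhs x)).
    apply: (@cvgXp _ _ (nbhs x)).
    apply: (@cvgB _ _ _ (nbhs x)); last exact: continuous_sqnorm.
    exact: (@cvg_cst _ _ _ (nbhs x)).
  apply: (@cvgM _ _ (nbhs x)).
    apply: (@cvg_sump _ _ (nbhs x)) => i; apply: (@cvgXp _ _ (nbhs x)).
    exact: u1c.
  apply: (@cvg_expRp _ _ (nbhs x)); apply: (@cvgM _ _ (nbhs x)).
    exact: (@cvg_cst _ _ _ (nbhs x)).
  by apply: (@cvg_lnp _ _ (nbhs x)) => //; exact: upos.
have [x0 + Jmax] : exists2 x, x \in B & forall t, t \in B -> J t <= J x.
  by apply: EVT_max_rV => //; exists 0.
rewrite inE => x0B.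
have e0 : 0 < eta 0 by rewrite /eta sqnorm0 subr0 exprn_gt0.
have J0 : 0 < J x0.
  by apply: lt_le_trans (J_gt0 e0 z00) _; apply: Jmax; rewrite inE.
have ex0 : 0 < eta x0.
  rewrite lt_def subr_ge0 x0B andbT; apply/eqP => E.
  by move: J0; rewrite /J E expr0n gtn_eqF // mul0r ltxx.
have zx0 : 0 < z x0.
  rewrite lt_def sumr_ge0 ?andbT; last by move=> i _; exact: sqr_ge0.
  by apply/eqP => E; move: J0; rewrite /J E mul0r mulr0 ltxx.
have cmp x : B x -> 0 < eta x -> 0 < z x ->
    k%:R * ln (eta x) + (ln (z x) - 2 * mu * ln (u x)) <=
    k%:R * ln (eta x0) + (ln (z x0) - 2 * mu * ln (u x0)).
  move=> xB ex zx; rewrite -!lnJ // ler_ln ?posrE ?J_gt0 //.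
  by apply: Jmax; rewrite inE.
exists x0; split => //; first exact: Br.
- have A1 : \forall x \near x0, 0 < eta x.
    have ec : eta x @[x --> x0] --> eta x0.
      apply: (@cvgB _ _ _ (nbhs x0)); last exact: continuous_sqnorm.
      exact: (@cvg_cst _ _ _ (nbhs x0)).
    exact: (cvgr_gt (eta x0) ec _ ex0).
  have A2 : \forall x \near x0, 0 < z x.
    have zc : z x @[x --> x0] --> z x0.
      apply: (@cvg_sump _ _ (nbhs x0)) => i; apply: (@cvgXp _ _ (nbhs x0)).
      by have [_ _ C _ _] := Ck2_regular reg (Br _ x0B); exact: C.
    exact: (cvgr_gt (z x0) zc _ zx0).
  apply: filterS2 A1 A2 => x ex zx.
  have xB : B x by rewrite /B /= -subr_ge0 ltW.
  by rewrite !(addrCA (ln _)); exact: cmp.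
- by have := cmp 0 B0 e0 z00; rewrite {1}/eta sqnorm0 subr0.
Qed.

End WeightedMaximum.

Lemma enorm_gradient_powR (R : realType) (N : nat) (u : 'rV[R]_N -> R)
    (x : 'rV[R]_N) (a : R) :
  0 < a -> 0 < u x ->
  (forall i, is_derive x (basis R i) u (partial i u x)) ->
  enorm (gradient (fun x => u x `^ a) x) =
    a * u x `^ (a - 1) * Num.sqrt (grad2 u x).
Proof.
move=> a0 ux D.
have c0 : 0 <= a * u x `^ (a - 1) by rewrite mulr_ge0 ?powR_ge0 // ltW.
rewrite /enorm.
have -> : \sum_i gradient (fun x => u x `^ a) x ord0 i ^+ 2 =
    (a * u x `^ (a - 1)) ^+ 2 * grad2 u x.
  rewrite mulr_sumr; apply: eq_bigr => i _; rewrite mxE -exprMn.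
  have [_ E] := is_derive_compp (is_derive1_powR a ux) (D i).
  by rewrite [partial i _ x]E.
by rewrite sqrtrM ?sqr_ge0 // sqrtr_sqr ger0_norm.
Qed.

Unset Implicit Arguments.

Theorem theoremB (R : realType) (N : nat) (p q : R)
    (hN : (2 <= N)%N) (hq : 0 <= q < 2) (hp : 0 <= p) (hpq : 0 < p + q - 1)
    (hcase :
      (1 <= p < (N%:R + 3) / (N%:R - 1) /\ p + q - 1 < 4 / (N%:R - 1)) \/
      (0 <= p < 1 /\ ((p + q - 1)%:E < exponent_bound N p)%E)) :
  exists a c1 : R,
    [/\ 0 < a, 0 < c1 &
      forall (r : R) (u : 'rV[R]_N -> R),
        0 < r -> positive_solution p q (eball r) u ->
        enorm (gradient (fun x => u x `^ a) 0)
          <= c1 * r `^ (- 1 - a * ((2 - q) / (p + q - 1)))].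
Proof.
have n0 : 0 < N%:R - 1 :> R by rewrite subr_gt0 ltr1n.
have /andP[_ q2] := hq.
have [s s1 hs] : exists2 s, 1 < s &
    (N%:R - 1) * (p + q - 1) < 2 + 2 * s - p * (s ^+ 2 - 1).
  apply: exists_exponent => //.
  case: hcase => -[/andP[p1 p2] H]; [left|right]; split => //.
    by rewrite mulrC -ltr_pdivlMr.
  move: H; rewrite /exponent_bound; case: eqP => [->|/eqP pn0]; first by left.
  rewrite lte_fin => H; right; rewrite mulrC -ltr_pdivlMr //.
  by rewrite -mulrA -invfM.
have [mu0 mu1 AE hB] := exponent_identities n0 s1 hs.
set mu := (N%:R - 1) / _ in mu0 mu1 AE hB.
have [C C0 HC] := absorb_cutoff n0 mu0 (lt_trans ltr01 s1) AE hB.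
pose a := 1 - mu.
have a0 : 0 < a by rewrite subr_gt0.
have a1 : a < 1 by rewrite gtrBl.
pose d := 1 + a * ((2 - q) / (p + q - 1)).
have d0 : 0 < d.
  by rewrite addr_gt0 // mulr_gt0 // divr_gt0 // subr_gt0.
(* [k = 2 * d] is the critical power of the cutoff. *)
pose k := Num.bound (2 * d).
have dk : 2 * d < k%:R by apply: archi_boundP; rewrite mulr_ge0 // ltW.
have k0 : (0 < k)%N.
  by rewrite -(ltr_nat R); apply: lt_trans dk; rewrite mulr_gt0.
have kR : 0 < k%:R :> R by rewrite ltr0n.
pose C2 := C * (4 * k%:R ^+ 2 + k%:R * (2 * N%:R + 4)).
have C20 : 0 < C2.
  apply: mulr_gt0 => //; apply: addr_gt0; apply: mulr_gt0 => //.
  exact: exprn_gt0.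
(* The factor [expR (d * ln 2)] accounts for working in the ball of radius
   [r / 2]. *)
exists a, (a * expR (d * (ln C2 / 2 + ln 2))); split => //.
  by rewrite mulr_gt0 // expR_gt0.
move=> r u r0 sol; have [reg upos _] := sol.
have b0 : eball r (0 : 'rV[R]_N).
  by apply/eballE => //; rewrite sqnorm0 exprn_gt0.
have u0 := upos 0 b0.
have [_ D _ _ _] := Ck2_regular reg b0.
rewrite (enorm_gradient_powR a0 u0 D).
have rhs0 : 0 <= r `^ (-1 - a * ((2 - q) / (p + q - 1))) by exact: powR_ge0.
have [z00|z0n] := eqVneq (grad2 u 0) 0.
  by rewrite z00 sqrtr0 mulr0 mulr_ge0 // mulr_ge0 ?expR_ge0 // ltW.
have z0 : 0 < grad2 u 0.
  by rewrite lt_def z0n; apply: sumr_ge0 => i _; exact: sqr_ge0.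
pose rho := r / 2.
have rho0 : 0 < rho by rewrite divr_gt0.
have rhor : 0 < rho < r by rewrite rho0 /rho ltr_pdivrMr // mulrDr mulr1 ltrDl.
have [x0 [e0 zx0 x0r lmax gmax]] :=
  weighted_max_exists mu k0 rhor sol z0.
have ux0 := upos x0 x0r.
have bound := interior_max_bound hN r0 sol x0r e0 zx0 HC lmax.
set et := rho ^+ 2 - sqnorm x0 in e0 bound gmax.
set z := grad2 u x0 in zx0 bound gmax.
set f := expR _ in bound.
have S0 : 0 < (z / u x0) ^+ 2 + f ^+ 2.
  by rewrite addr_gt0 // exprn_gt0 ?expR_gt0 // divr_gt0.
have h1 : 2 * (ln z - ln (u x0)) <= ln ((z / u x0) ^+ 2 + f ^+ 2).
  rewrite -ln_div ?posrE // mulr_natl -lnXn ?divr_gt0 //.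
  by rewrite ler_ln ?posrE ?exprn_gt0 ?divr_gt0 // lerDl sqr_ge0.
have h2 : 2 * (p * ln (u x0) + q / 2 * ln z) <= ln ((z / u x0) ^+ 2 + f ^+ 2).
  rewrite -[X in 2 * X]expRK -/f mulr_natl -lnXn ?expR_gt0 //.
  by rewrite ler_ln ?posrE ?exprn_gt0 ?expR_gt0 // lerDr sqr_ge0.
have a01 : 0 < a < 1 by rewrite a0.
have h3 := log_interpolation hp hpq q2 a01 (erefl d) h1 h2.
have h4 : ln ((z / u x0) ^+ 2 + f ^+ 2) <=
    ln C2 + ln z + 2 * ln rho - 2 * ln et.
  have lnE (c w v e : R) : 0 < c -> 0 < w -> 0 < v -> 0 < e ->
      ln (c * w * (v ^+ 2 / e ^+ 2)) = ln c + ln w + 2 * ln v - 2 * ln e.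
    move=> c0 w0 v0 e_gt0.
    rewrite lnM ?posrE ?mulr_gt0 ?invr_gt0 ?exprn_gt0 //.
    rewrite lnM ?posrE // ln_div ?posrE ?exprn_gt0 // !lnXn //.
    by rewrite !mulr_natl addrA.
  have P : 0 < C2 * z * (rho ^+ 2 / et ^+ 2).
    apply: mulr_gt0; first exact: mulr_gt0.
    by apply: divr_gt0; exact: exprn_gt0.
  rewrite -lnE // ler_ln ?posrE //.
  apply: le_trans bound _; rewrite /C2 le_eqVlt; apply/orP; left.
  by apply/eqP; ring.
have h5 : ln et <= 2 * ln rho.
  rewrite mulr_natl -lnXn // ler_ln ?posrE ?exprn_gt0 //.
  by rewrite gerBl sqnorm_ge0.
have h6 : ln (grad2 u 0) - 2 * mu * ln (u 0) <= d * (ln C2 - 2 * ln rho).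
  have am : 1 - a = mu by rewrite /a opprB addrCA subrr addr0.
  rewrite am in h3; rewrite lnXn // -[ln rho *+ 2]mulr_natl in gmax.
  exact: centre_bound d0 (ltW dk) h3 h4 h5 gmax.
have lnrho : ln rho = ln r - ln 2 by rewrite ln_div ?posrE.
have -> : a * u 0 `^ (a - 1) * Num.sqrt (grad2 u 0) =
    a * expR ((ln (grad2 u 0) - 2 * mu * ln (u 0)) / 2).
  rewrite -powR12_sqrt ?ltW // /powR !gt_eqF // -mulrA -expRD.
  by congr (_ * expR _); rewrite /a; field.
have -> : -1 - a * ((2 - q) / (p + q - 1)) = - d by rewrite /d opprD.
have -> : r `^ (- d) = expR (- d * ln r) by rewrite /powR gt_eqF.
rewrite -[leRHS]mulrA -expRD ler_pM2l // ler_expR ler_pdivrMr //.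
apply: le_trans h6 _; rewrite lnrho le_eqVlt; apply/orP; left; apply/eqP.
by field.
Qed.
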